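(* Let $\Phi$ be a crystallographic root system with Weyl group $W$ and simple system $\Pi$, and let $n\ge1$. Let $P_n$ be the set of all pairs $(\beta,\Gamma)$ such that $\beta$ is a dominant root of $\Phi$, $\Gamma$ is the vertex set of a type $A_n$ subdiagram of the Dynkin diagram of $\{\beta\}\cup-\Pi$, and $\beta$ is a terminal vertex of $\Gamma$. Let $\omega_\Pi$ be the longest element of $W$, let $\rho=-\omega_\Pi$, regarded as an automorphism of $\Phi$, and let $H=\langle\rho\rangle=\{1,\rho\}$, which acts naturally on $P_n$ (as $\rho$ preserves $\Pi$ and fixes every dominant root). Then the set of $W$-conjugacy classes of simple systems of type $A_n$ in $\Phi$ is in bijection with the set $P_n/H$ of $H$-orbits on $P_n$.
   Context: $V$ is a finite-dimensional real Euclidean space with inner product $\langle-,-\rangle$; for $0\ne\alpha\in V$, $\alpha^\vee=2\alpha/\langle\alpha,\alpha\rangle$ and $s_\alpha(v)=v-\langle v,\alpha^\vee\rangle\alpha$. A root system $\Phi$ in $V$ is a finite subset of $V\setminus\{0\}$ with $s_\alpha(\beta)\in\Phi$ for $\alpha,\beta\in\Phi$, and such that $\alpha,c\alpha\in\Phi$ implies $c=\pm1$; it may be reducible and need not span $V$. It is crystallographic if $\langle\alpha,\beta^\vee\rangle\in\mathbb{Z}$ for all $\alpha,\beta\in\Phi$. $W=\langle s_\alpha\mid\alpha\in\Phi\rangle$. A simple system $\Pi$ of $\Phi$ is a linearly independent subset with $\Phi=\Phi_+\sqcup-\Phi_+$, $\Phi_+=\Phi\cap\mathbb{R}_{\ge0}\Pi$.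 The longest element $\omega_\Pi$ is with respect to the Coxeter generators $\{s_\alpha\mid\alpha\in\Pi\}$. A root subsystem of $\Phi$ is a set $\Phi_{W'}=\{\alpha\in\Phi\mid s_\alpha\in W'\}$, where $W'\le W$ is generated by reflections $s_\alpha$, $\alpha\in\Phi$. ''Simple systems of type $A_n$ in $\Phi$'' are the simple subsystems of type $A_n$, i.e. subsets of $\Phi$ that are simple systems, with Cartan matrix of type $A_n$, of some root subsystem of $\Phi$; $w\in W$ acts by $\Delta\mapsto w(\Delta)$. A root $\alpha\in\Phi$ is dominant if $\langle\alpha,\gamma\rangle\ge0$ for all $\gamma\in\Pi$ (for reducible $\Phi$ these are the dominant roots of its components). For a set $\Gamma\subseteq\Phi$ such that $\langle\alpha,\beta^\vee\rangle\le0$ for distinct $\alpha,\beta\in\Gamma$, its Dynkin diagram is the graph with vertex set $\Gamma$ which, with $m_{\alpha,\beta}=\langle\alpha^\vee,\beta\rangle$, joins distinct $\alpha,\beta$ with $|m_{\alpha,\beta}|\ge|m_{\beta,\alpha}|$ by $|m_{\alpha,\beta}|$ lines, with an arrow pointing towards $\alpha$ if $|m_{\alpha,\beta}|>1$ (two lines with arrows in both directions if $\alpha=-\beta$). The set $\{\beta\}\cup-\Pi$ with $\beta$ dominant has this property. ''Subdiagram'' means full subdiagram on a subset of vertices. $H$ acts on $P_n$ by $\rho(\beta,\Gamma)=(\rho(\beta),\rho(\Gamma))=(\beta,\rho(\Gamma))$. *)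

(* Defs.v *)
From HB Require Import structures.
From mathcomp Require Import all_boot all_order all_algebra finmap.
From mathcomp Require Import sesquilinear.
From mathcomp Require Import all_classical all_reals.

Set Implicit Arguments.
Unset Strict Implicit.
Unset Printing Implicit Defensive.

Import Order.TTheory GRing.Theory Num.Theory.

Local Open Scope classical_set_scope.
Local Open Scope ring_scope.

Section RootSystems.
Variables (R : realType) (V : vectType R) (ip : {dot V for idfun}).
Implicit Types (a b g : V) (Phi Psi Pi Delta Gamma A : {fset V}).

Definition coroot a : V := (2 / ip a a) *: a.

Definition reflection a (v : V) : V := v - ip v (coroot a) *: a.

Fact reflection_is_linear a : linear (reflection a).
Proof.
move=> k u v; rewrite /reflection linearPl /= scalerDl scalerBr scalerA.
by rewrite opprD addrACA.
Qed.
HB.instance Definition _ a :=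
  GRing.isLinear.Build R V V _ (reflection a) (reflection_is_linear a).

Definition refl a : 'End(V) := linfun (reflection a).

Definition refl_word (s : seq V) : 'End(V) :=
  foldr (fun a w => (refl a \o w)%VF) \1%VF s.

(* Reflections are involutions, so the monoid generated by a set of reflections
   is the group generated by it. *)
Definition refl_group A : set 'End(V) :=
  [set w | exists2 s : seq V, {subset s <= A} & w = refl_word s].

Definition is_root_system Phi : Prop :=
  [/\ 0 \notin Phi,
      {in Phi &, forall a b, refl a b \in Phi} &
      {in Phi, forall a (c : R), c *: a \in Phi -> c = 1 \/ c = -1}].

Definition crystallographic Phi : Prop :=
  {in Phi &, forall a b, ip a (coroot b) \is a Num.int}.

Definition nonneg_span Pi : set V :=
  [set v | exists2 c : V -> R, {in Pi, forall a, 0 <= c a} &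
           v = \sum_(a <- Pi) c a *: a].

Definition positive_roots Phi Pi : set V := [set` Phi] `&` nonneg_span Pi.

Definition is_simple_system Phi Pi : Prop :=
  [/\ (Pi `<=` Phi)%fset,
      free Pi,
      [set` Phi] = positive_roots Phi Pi `|` -%R @` positive_roots Phi Pi &
      positive_roots Phi Pi `&` -%R @` positive_roots Phi Pi = set0].

Definition is_length Pi (w : 'End(V)) (k : nat) : Prop :=
  (exists s : seq V, [/\ {subset s <= Pi}, size s = k & w = refl_word s]) /\
  (forall s : seq V, {subset s <= Pi} -> w = refl_word s -> (k <= size s)%N).

Definition is_longest Phi Pi (w0 : 'End(V)) : Prop :=
  refl_group Phi w0 /\
  exists2 k, is_length Pi w0 k &
    forall w l, refl_group Phi w -> is_length Pi w l -> (l <= k)%N.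

Definition is_root_subsystem Phi Psi : Prop :=
  exists2 A, (A `<=` Phi)%fset &
    forall a, a \in Psi <-> a \in Phi /\ refl_group A (refl a).

Definition cartan_A (n : nat) : 'M[R]_n :=
  \matrix_(i, j) if i == j then 2
                 else if (i.+1 == j :> nat) || (j.+1 == i :> nat) then -1
                 else 0.

Definition cartan_type_A (n : nat) Delta : Prop :=
  exists e : 'I_n -> V,
    [/\ injective e, [set` Delta] = range e &
        \matrix_(i, j) ip (e i) (coroot (e j)) = cartan_A n].

Definition simple_subsystem_A Phi (n : nat) : set {fset V} :=
  [set Delta | (exists2 Psi, is_root_subsystem Phi Psi &
                             is_simple_system Psi Delta) /\
               cartan_type_A n Delta].

Definition dominant Phi Pi : set V :=
  [set b | b \in Phi /\ {in Pi, forall g, 0 <= ip b g}].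

(* [lines] is only meaningful on pairs of distinct vertices; it is real-valued
   because it is computed from the inner product.  [arrow a b] means that the
   lines joining [a] and [b] carry an arrow pointing towards [a]. *)
Record diagram := Diagram {
  vertices : {fset V};
  lines : V -> V -> R;
  arrow : V -> V -> bool }.

Definition cartan_integer a b : R := ip (coroot a) b.

Definition dynkin Gamma : diagram := {|
  vertices := Gamma;
  lines := fun a b =>
    Num.max `|cartan_integer a b| `|cartan_integer b a|;
  arrow := fun a b =>
    (`|cartan_integer b a| <= `|cartan_integer a b|) &&
    (1 < `|cartan_integer a b|) |}.

Definition full_subdiagram (D : diagram) Gamma : diagram :=
  {| vertices := Gamma; lines := lines D; arrow := arrow D |}.

Definition diagram_type_A (n : nat) (D : diagram) : Prop :=
  exists e : 'I_n -> V,
    [/\ injective e, [set` vertices D] = range e &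
        forall i j : 'I_n, i != j ->
          lines D (e i) (e j) =
            (if (i.+1 == j :> nat) || (j.+1 == i :> nat) then 1 else 0) /\
          ~~ arrow D (e i) (e j)].

(* A vertex joined to at most one other vertex; in particular the only vertex
   of a diagram of type [A_1] is terminal. *)
Definition terminal (D : diagram) b : Prop :=
  b \in vertices D /\
  (#|` [fset a in vertices D | (a != b) && (lines D a b != 0%R)]%fset| <= 1)%N.

Definition extended_diagram Pi b : diagram :=
  dynkin (b |` [fset - a | a in Pi])%fset.

Definition pairs_P Phi Pi (n : nat) : set (V * {fset V}) :=
  [set p | [/\ dominant Phi Pi p.1,
      (p.2 `<=` vertices (extended_diagram Pi p.1))%fset,
      diagram_type_A n (full_subdiagram (extended_diagram Pi p.1) p.2) &
      terminal (full_subdiagram (extended_diagram Pi p.1) p.2) p.1]].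

Definition act_fset (w : 'End(V)) Delta : {fset V} := [fset w a | a in Delta]%fset.

Definition act_pair (w : 'End(V)) (p : V * {fset V}) : V * {fset V} :=
  (w p.1, act_fset w p.2).

End RootSystems.

Definition orbits (T X : Type) (act : T -> X -> X) (G : set T) (A : set X) :
    set (set X) :=
  [set [set act g x | g in G] | x in A].

(* Main.v *)
Require Import Defs.
From mathcomp Require Import all_boot all_order all_algebra finmap.
From mathcomp Require Import sesquilinear.
From mathcomp Require Import all_classical all_reals.
From mathcomp Require Import zify ring lra.

Import Order.TTheory GRing.Theory Num.Theory.
Local Open Scope classical_set_scope.
Local Open Scope card_scope.
Local Open Scope ring_scope.

(** A simple system of type A_n is the set of entries of a chain: a list whose
    matrix of Cartan integers is the Cartan matrix of type A_n, with its nodes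
    in order along the diagram. A chain is determined by its set of entries up
    to reversal ([A_chain_eq_mem]), and any chain of roots is a simple system of
    the subsystem that its reflections generate ([A_chain_simple_system]). So
    the theorem amounts to classifying chains under the Weyl group W and then
    dividing by reversal.

    Classification. Call a chain normal if its first entry is a dominant root
    and all the others are negatives of simple roots; the pairs (beta, Gamma)
    are exactly the normal chains ([pairsP]). Every chain of roots is
    W-conjugate to one and only one normal chain ([normal_exists],
    [normal_uniq]), because the entries can be normalised one after the other.
    Move the first entry into the closed fundamental chamber. Suppose that the
    last normalised entry a is dominant for a set J of simple roots whose
    reflections fix all the entries before a. The stabiliser of a in the group
    of J is generated by the reflections in K, the part of J orthogonal to a
    ([dom_stab]); the remaining freedom is the group of K, and it suffices to
    bring the opposite of the next entry into J ([conj_to_simple]). That image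
    is unique, since the group of K only adds combinations of K to a simple
    root.

    Reversal. The longest element of the Weyl group of a chain s maps s to
    minus its reversal ([chain_flip]). Hence the reversal of a normal chain s is
    W-conjugate to -s, and so to -w0 s, where w0 is the longest element of W.
    Now rho = -w0 permutes the simple roots and fixes the dominant ones, so
    rho s is again normal: it is the normal form of the reversal of s.
    Therefore two normal chains have W-conjugate sets of entries exactly when
    they are equal or exchanged by rho. *)

Set Implicit Arguments.
Unset Strict Implicit.
Unset Printing Implicit Defensive.

(** * Preliminaries *)

Lemma sub_cons (T : eqType) (a : T) (s : seq T) (P : {pred T}) :
  {subset a :: s <= P} -> a \in P /\ {subset s <= P}.
Proof.
by move=> h; split=> [|x xs]; apply: h; rewrite inE ?eqxx // xs orbT.
Qed.

Lemma seq_argmax (R : realType) (T : eqType) (s : seq T) (P : T -> Prop) (f : T -> R) x0 :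
  x0 \in s -> P x0 ->
  exists x, [/\ x \in s, P x & forall y, y \in s -> P y -> f y <= f x].
Proof.
elim: s x0 => // a s IH x0 x0s Px0.
have [[y ys Py]|noy] := pselect (exists2 y, y \in s & P y).
  have [x [xs Px xmax]] := IH y ys Py.
  have [[Pa fa]|h] := pselect (P a /\ f x <= f a).
    exists a; split=> // [|z]; rewrite inE ?eqxx // => /orP[/eqP ->|zs Pz] //.
    exact: le_trans (xmax z zs Pz) fa.
  exists x; split=> // [|z]; first by rewrite inE xs orbT.
  rewrite inE => /orP[/eqP ->|/xmax//] Pa.
  by rewrite leNgt; apply/negP => /ltW fa; apply: h.
move: x0s; rewrite inE => /orP[/eqP e|x0s]; last by case: noy; exists x0.
rewrite e in Px0; exists a; split; rewrite ?mem_head // => z.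
by rewrite inE => /orP[/eqP ->|zs Pz] //; case: noy; exists z.
Qed.

Lemma int_ge1 (R : realType) (x : R) : x \is a Num.int -> 0 < x -> 1 <= x.
Proof. by move=> /intrP[m ->]; rewrite ltr0z ler1z. Qed.

(** By injectivity a step never undoes the previous one, so all the steps go in
    the same direction, and each direction leaves room for only one path. *)
Lemma straight_path n (p : nat -> nat) :
  (forall i, i < n -> p i < n)%N ->
  (forall i j, i < n -> j < n -> p i = p j -> i = j)%N ->
  (forall i, i.+1 < n -> p i.+1 = (p i).+1 \/ p i = (p i.+1).+1)%N ->
  (forall i, i < n -> p i = i)%N \/ (forall i, i < n -> p i = n.-1 - i)%N.
Proof.
move=> pn pinj padj; have [n1|n1] := leqP n 1.
  by left=> i i_n; have := pn i i_n; lia.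
have [up|down] := padj 0%N n1; [left|right].
- have H i : (i.+1 < n)%N -> (p i = p 0%N + i)%N /\ (p i.+1 = p 0%N + i.+1)%N.
    elim: i => [_|i IH i_n]; first by rewrite up; lia.
    have [e1 e2] := IH (ltnW i_n); split=> //.
    case: (padj i.+1 i_n) => e; first lia.
    by have := pinj i i.+2 ltac:(lia) i_n ltac:(lia); lia.
  have := pn n.-1 ltac:(lia); have [_] := H n.-2 ltac:(lia).
  have -> : n.-2.+1 = n.-1 by lia.
  by move=> -> ? [|i] i_n; last have [_ ->] := H i i_n; lia.
- have H i : (i.+1 < n)%N -> (p i + i = p 0)%N /\ (p i.+1 + i.+1 = p 0)%N.
    elim: i => [_|i IH i_n]; first by rewrite down; lia.
    have [e1 e2] := IH (ltnW i_n); split=> //.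
    case: (padj i.+1 i_n) => e; last lia.
    by have := pinj i i.+2 ltac:(lia) i_n ltac:(lia); lia.
  have := pn 0%N ltac:(lia); have [_] := H n.-2 ltac:(lia).
  have -> : n.-2.+1 = n.-1 by lia.
  move=> e p0; have e0 : p 0%N = n.-1 by lia.
  by move=> [|i] i_n; [|have [_] := H i i_n]; lia.
Qed.

(** Lists indexed by [nat] are easier to traverse than functions on ordinals;
    this turns an enumeration of the second kind into one of the first. *)
Lemma fset_of_ord_fun (V : choiceType) (x0 : V) n (e : 'I_n -> V) (D : {fset V}) :
  [set` D] = range e ->
  exists s, [/\ size s = n, forall i : 'I_n, nth x0 s i = e i & D = [fset x in s]%fset].
Proof.
move=> De; exists [seq e i | i <- enum 'I_n]; split.
- by rewrite size_map size_enum_ord.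
- by move=> i; rewrite (nth_map i) ?size_enum_ord // nth_ord_enum.
- apply/fsetP => x; rewrite !inE; have : [set` D] x <-> range e x by rewrite De.
  move=> [h1 h2]; apply/idP/mapP => [/h1[i _ <-]|[i _ xE]].
    by exists i; rewrite ?mem_enum.
  by apply: h2; exists i.
Qed.

(** Both images are the quotient of [A] by the same equivalence relation. *)
Lemma card_eq_image_kernel (T U U' : Type) (A : set T)
    (f : T -> set U) (g : T -> set U') :
  (forall x y, A x -> A y -> f x = f y <-> g x = g y) ->
  f @` A #= g @` A.
Proof.
move=> fg.
pose h S := if pselect (exists x, A x /\ f x = S) is left e
  then g (projT1 (cid e)) else set0.
have hE x : A x -> h (f x) = g x.
  move=> Ax; rewrite /h; case: pselect => [e|[]]; last by exists x.
  by case: cid => y /= [Ay fy]; apply/fg.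
apply/card_set_bijP; exists h; split.
- by move=> _ [x Ax <-]; rewrite hE //; exists x.
- move=> _ _ /set_mem[x Ax <-] /set_mem[y Ay <-]; rewrite !hE // => ?.
  exact/fg.
- by move=> _ [x Ax <-]; exists (f x); [exists x | rewrite hE].
Qed.

(** * Reflections *)

Section Reflections.
Variables (R : realType) (V : vectType R) (ip : {dot V for idfun}).
Implicit Types (a b g u v : V) (s t : seq V) (w : 'End(V)) (A B : {fset V}).

Local Notation refl := (refl ip).
Local Notation coroot := (coroot ip).
Local Notation word := (refl_word ip).
Local Notation group := (refl_group ip).

Lemma ipC u v : ip u v = ip v u.
Proof. by rewrite hermC expr0 mul1r. Qed.

Lemma ipDl u v b : ip (u + v) b = ip u b + ip v b.
Proof. by rewrite linearDl. Qed.
Lemma ipNl u b : ip (- u) b = - ip u b.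
Proof. by rewrite linearNl. Qed.
Lemma ipZl (k : R) u b : ip (k *: u) b = k * ip u b.
Proof. by rewrite linearZl_LR. Qed.
Lemma ip0l b : ip 0 b = 0.
Proof. by rewrite linear0l. Qed.
Lemma ipDr u v b : ip b (u + v) = ip b u + ip b v.
Proof. by rewrite linearDr. Qed.
Lemma ipNr u b : ip b (- u) = - ip b u.
Proof. by rewrite linearNr. Qed.
Lemma ipZr (k : R) u b : ip b (k *: u) = k * ip b u.
Proof. by rewrite linearZr_LR. Qed.
Lemma ip_suml (I : Type) (r : seq I) (P : pred I) (F : I -> V) b :
  ip (\sum_(i <- r | P i) F i) b = \sum_(i <- r | P i) ip (F i) b.
Proof. by rewrite linear_sumlz. Qed.

Lemma ip_gt0 v : v != 0 -> 0 < ip v v.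
Proof. exact: neq0_dnorm_gt0. Qed.
Lemma ip_neq0 v : v != 0 -> ip v v != 0.
Proof. by move=> /ip_gt0; rewrite lt_def => /andP[]. Qed.

Lemma pairE u a : ip u (coroot a) = 2 / ip a a * ip u a.
Proof. by rewrite /coroot ipZr. Qed.

Lemma pair_self a : a != 0 -> ip a (coroot a) = 2.
Proof. by move=> /ip_neq0 a0; rewrite pairE mulfVK. Qed.

Lemma pair_eq0 u a : a != 0 -> (ip u (coroot a) == 0) = (ip u a == 0).
Proof.
move=> /ip_neq0 a0.
by rewrite pairE mulf_eq0 mulf_eq0 invr_eq0 (negbTE a0) pnatr_eq0.
Qed.

Lemma pair_gt0 u a : a != 0 -> (0 < ip u (coroot a)) = (0 < ip u a).
Proof.
by move=> /ip_gt0 a0; rewrite pairE pmulr_rgt0 // divr_gt0 // ltr0n.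
Qed.

Lemma pair_ge0 u a : a != 0 -> (0 <= ip u (coroot a)) = (0 <= ip u a).
Proof.
by move=> /ip_gt0 a0; rewrite pairE pmulr_rge0 // divr_gt0 // ltr0n.
Qed.

Lemma corootN a : coroot (- a) = - coroot a.
Proof. by rewrite /coroot ipNl ipNr opprK scalerN. Qed.

Lemma reflE a v : refl a v = v - ip v (coroot a) *: a.
Proof. by rewrite lfunE. Qed.

Lemma reflN a : refl (- a) = refl a.
Proof. by apply/lfunP => v; rewrite !reflE corootN ipNr scaleNr scalerN opprK. Qed.

Lemma refl_self a : refl a a = - a.
Proof.
rewrite reflE; have [->|a0] := eqVneq a 0; first by rewrite scaler0 subr0 oppr0.
by rewrite pair_self // scaler_nat mulr2n opprD addrA subrr add0r.
Qed.

Lemma refl_fix a v : ip v a = 0 -> refl a v = v.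
Proof. by move=> h; rewrite reflE pairE h mulr0 scale0r subr0. Qed.

Lemma refl_isom a u v : ip (refl a u) (refl a v) = ip u v.
Proof.
rewrite !reflE !pairE !(ipDl, ipNl, ipZl, ipDr, ipNr, ipZr) (ipC a v).
have [->|/ip_neq0 a0] := eqVneq a 0; first by rewrite !ip0l !(mulr0, mul0r); ring.
by field.
Qed.

Lemma reflK a v : refl a (refl a v) = v.
Proof.
rewrite !reflE ipDl ipNl ipZl; have [->|a0] := eqVneq a 0.
  by rewrite !scaler0 !subr0.
rewrite pair_self // -addrA -opprD -scalerDl [X in X *: a](_ : _ = 0); last by ring.
by rewrite scale0r subr0.
Qed.

Lemma endZ w (k : R) v : w (k *: v) = k *: w v.
Proof. exact: linearZ. Qed.
Lemma endD w u v : w (u + v) = w u + w v.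
Proof. exact: linearD. Qed.
Lemma endB w u v : w (u - v) = w u - w v.
Proof. exact: linearB. Qed.
Lemma endN w v : w (- v) = - w v.
Proof. exact: linearN. Qed.
Lemma end_sum w (I : Type) (r : seq I) (P : pred I) (F : I -> V) :
  w (\sum_(i <- r | P i) F i) = \sum_(i <- r | P i) w (F i).
Proof. exact: linear_sum. Qed.

(** * Groups generated by reflections *)

Lemma word_cons a s v : word (a :: s) v = refl a (word s v).
Proof. by rewrite /= comp_lfunE. Qed.

Lemma word_nil v : word [::] v = v.
Proof. by rewrite /= id_lfunE. Qed.

Lemma word_cat s t v : word (s ++ t) v = word s (word t v).
Proof. by elim: s => [|a s IH]; rewrite ?cat0s ?cat_cons ?word_nil // !word_cons IH. Qed.

Lemma word_rcons s a v : word (rcons s a) v = word s (refl a v).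
Proof. by rewrite -cats1 word_cat word_cons word_nil. Qed.

Lemma word_revK s v : word (rev s) (word s v) = v.
Proof.
elim: s => [|a s IH]; first by rewrite /rev /= !id_lfunE.
by rewrite rev_cons word_rcons word_cons reflK.
Qed.

Lemma word_isom s u v : ip (word s u) (word s v) = ip u v.
Proof. by elim: s => [|a s IH]; rewrite ?word_nil // !word_cons refl_isom. Qed.

Lemma group1 A : group A \1%VF.
Proof. by exists [::]. Qed.

Lemma group_refl A a : a \in A -> group A (refl a).
Proof.
move=> aA; exists [:: a]; first by move=> x; rewrite inE => /eqP ->.
by apply/lfunP => v; rewrite word_cons word_nil.
Qed.

Lemma group_word A s : {subset s <= A} -> group A (word s).
Proof. by exists s. Qed.

Lemma groupM A w1 w2 : group A w1 -> group A w2 -> group A (w1 \o w2)%VF.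
Proof.
move=> [s sA ->] [t tA ->]; exists (s ++ t).
  by move=> x; rewrite mem_cat => /orP[/sA|/tA].
by apply/lfunP => v; rewrite comp_lfunE word_cat.
Qed.

Lemma groupV A w : group A w ->
  exists w', [/\ group A w', cancel w w' & cancel w' w].
Proof.
move=> [s sA ->]; exists (word (rev s)); split.
- by apply: group_word => x; rewrite mem_rev => /sA.
- exact: word_revK.
- by move=> v; rewrite -{1}(revK s) word_revK.
Qed.

Lemma groupS A B w : {subset A <= B} -> group A w -> group B w.
Proof. by move=> AB [s sA ->]; exists s => // x /sA /AB. Qed.

Lemma group_isom A w u v : group A w -> ip (w u) (w v) = ip u v.
Proof. by move=> [s _ ->]; rewrite word_isom. Qed.

Lemma group_pair A w u v : group A w -> ip (w u) (coroot (w v)) = ip u (coroot v).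
Proof. by move=> gw; rewrite !pairE !(group_isom _ _ gw). Qed.

Lemma group_refl_conj A w a v : group A w -> refl (w a) (w v) = w (refl a v).
Proof. by move=> gw; rewrite !reflE (group_pair _ _ gw) endB endZ. Qed.

Lemma group_fix A w v : {in A, forall a, ip v a = 0} -> group A w -> w v = v.
Proof.
move=> h [s sA ->]; elim: s sA => [|a s IH] sA; first by rewrite word_nil.
rewrite word_cons IH; first by rewrite refl_fix // h // sA // mem_head.
by move=> x xs; apply: sA; rewrite inE xs orbT.
Qed.

(** Induction on words, for properties that the generators preserve. *)
Lemma group_stable A (P : V -> Prop) w v :
  (forall a x, a \in A -> P x -> P (refl a x)) -> group A w -> P v -> P (w v).
Proof.
move=> h [s sA ->] Pv; elim: s sA => [|a s IH] sA; first by rewrite word_nil.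
rewrite word_cons; apply: h; first by rewrite sA // mem_head.
by apply: IH => x xs; apply: sA; rewrite inE xs orbT.
Qed.

End Reflections.

(** * Chains of type A *)

Section Chains.
Variables (R : realType) (V : vectType R) (ip : {dot V for idfun}).
Implicit Types (a b g u v : V) (s t : seq V) (w : 'End(V)) (A B : {fset V}).

Local Notation refl := (refl ip).
Local Notation coroot := (coroot ip).
Local Notation word := (refl_word ip).
Local Notation group := (refl_group ip).

Definition cartan_entry (i j : nat) : R :=
  if i == j then 2 else if (i.+1 == j) || (j.+1 == i) then -1 else 0.

Definition A_chain s : Prop := forall i j, (i < size s)%N -> (j < size s)%N ->
  ip s`_i (coroot s`_j) = cartan_entry i j.

Lemma cartan_entryC i j : cartan_entry i j = cartan_entry j i.
Proof. by rewrite /cartan_entry eq_sym orbC. Qed.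

Lemma A_chain_neq0 s a : A_chain s -> a \in s -> a != 0.
Proof.
move=> ch /(nthP 0)[i si <-]; apply/eqP => e.
have := ch i i si si; rewrite e ip0l /cartan_entry eqxx => /eqP.
by rewrite eq_sym pnatr_eq0.
Qed.

Lemma A_chain_behead a s : A_chain (a :: s) -> A_chain s.
Proof. by move=> ch i j si sj; apply: (ch i.+1 j.+1). Qed.

Lemma A_chain_head2 a b s : A_chain (a :: b :: s) ->
  ip a (coroot b) = -1 /\ ip b (coroot a) = -1.
Proof. by move=> ch; split; [apply: (ch 0%N 1%N) | apply: (ch 1%N 0%N)]. Qed.

Lemma A_chain_orth a b s x : A_chain (a :: b :: s) -> x \in s -> ip a x = 0.
Proof.
move=> ch xs; have a0 : a != 0 by apply: A_chain_neq0 ch _; rewrite mem_head.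
apply/eqP; rewrite ipC -(pair_eq0 ip _ a0); apply/eqP.
by move: xs => /(nthP 0)[i si <-]; apply: (ch i.+2 0%N).
Qed.

Lemma A_chain_map (f : V -> V) s :
  {in s &, forall u v, ip (f u) (coroot (f v)) = ip u (coroot v)} ->
  A_chain s -> A_chain (map f s).
Proof.
move=> h ch i j; rewrite size_map => si sj.
by rewrite !(nth_map 0) // h ?mem_nth // ch.
Qed.

Lemma A_chain_group A w s : group A w -> A_chain s -> A_chain (map w s).
Proof. by move=> gw; apply: A_chain_map => u v _ _; rewrite (group_pair _ _ gw). Qed.

Lemma A_chain_rev s : A_chain s -> A_chain (rev s).
Proof.
move=> ch i j; rewrite size_rev => si sj.
have sub n k : (k < n -> n - k.+1 < n)%N by lia.
rewrite !nth_rev // ch; try exact: sub.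
rewrite /cartan_entry; move: (size s) si sj => n si sj.
have -> : ((n - i.+1 == n - j.+1) = (i == j))%N by lia.
have -> : (((n - i.+1).+1 == n - j.+1) = (j.+1 == i))%N by lia.
have -> : (((n - j.+1).+1 == n - i.+1) = (i.+1 == j))%N by lia.
by rewrite orbC.
Qed.

Lemma A_chain_uniq s : A_chain s -> uniq s.
Proof.
move=> ch; apply/(uniqP 0) => i j; rewrite !inE => si sj e.
have := ch i j si sj; rewrite e ch // /cartan_entry eqxx.
case: eqP => // _; case: ifP => _ /eqP.
  by rewrite -subr_eq0 opprK -(natrD _ 2 1) pnatr_eq0.
by rewrite pnatr_eq0.
Qed.

(** The position in [s] of the successive entries of [t] moves by one step at
    a time without repetition. *)
Lemma A_chain_eq_mem s t : A_chain s -> A_chain t -> s =i t -> t = s \/ t = rev s.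
Proof.
move=> cs ct st; have us := A_chain_uniq cs; have ut := A_chain_uniq ct.
have sz : size t = size s by apply/eqP; rewrite -(uniq_size_uniq us) // => x.
pose p i := index t`_i s.
have pn i : (i < size s)%N -> (p i < size s)%N.
  by move=> i_n; rewrite index_mem st mem_nth // sz.
have sp i : (i < size s)%N -> s`_(p i) = t`_i.
  by move=> i_n; rewrite nth_index // st mem_nth // sz.
have [] := @straight_path (size s) p pn.
- move=> i j si sj e; have : t`_i = t`_j by rewrite -!sp // e.
  by move/(uniqP 0 ut); rewrite !inE sz; apply.
- move=> i si; have := ct i i.+1; rewrite sz => /(_ (ltnW si) si).
  rewrite -!sp ?(ltnW si) // cs ?pn ?(ltnW si) // /cartan_entry eqxx.
  rewrite [i == i.+1](_ : _ = false); last lia.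
  case: eqP => [_ /= /eqP|_]; first by rewrite -subr_eq0 opprK -(natrD _ 2 1) pnatr_eq0.
  case: ifP => [/orP[] /eqP -> _|_ /eqP]; [by left|by right|].
  by rewrite eq_sym oppr_eq0 oner_eq0.
- move=> pE; left; apply: (@eq_from_nth _ 0) => // i; rewrite sz => si.
  by rewrite -sp // pE.
- move=> pE; right; apply: (@eq_from_nth _ 0) => [|i]; rewrite ?size_rev // sz => si.
  by rewrite -sp // pE // nth_rev // subnS predn_sub.
Qed.

Local Notation total s := (\sum_(x <- s) x).

(** All entries of [s] but the first are orthogonal to [a]. *)
Lemma word_prev a s : A_chain (a :: s) -> word s a = a + head 0 s.
Proof.
case: s => [|b s] ch /=; first by rewrite id_lfunE addr0.
have -> : (refl b \o word s)%VF a = refl b (word s a) by rewrite comp_lfunE.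
rewrite (@group_fix _ _ ip [fset x in s]%fset (word s)); first last.
- by apply: group_word => x; rewrite !inE.
- by move=> x; rewrite !inE; apply: A_chain_orth ch.
by rewrite reflE (A_chain_head2 ch).1 scaleN1r opprK.
Qed.

Lemma refl_prev_total a s : A_chain (a :: s) ->
  refl a (total s) = total s + a *+ (s != [::]).
Proof.
case: s => [|b s] ch; first by rewrite big_nil linear0 addr0.
have fixs : refl a (total s) = total s.
  apply: refl_fix; rewrite ip_suml big_seq big1 // => x xs.
  by rewrite ipC (A_chain_orth ch).
rewrite big_cons endD fixs reflE (A_chain_head2 ch).2 scaleN1r opprK mulr1n.
by rewrite addrAC.
Qed.

(** The Coxeter element of a chain acts as a long cycle. *)
Lemma word_cycle s : A_chain s -> s != [::] ->
  map (word s) s = rcons (behead s) (- total s).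
Proof.
elim: s => // a s IH ch _; have chs := A_chain_behead ch.
have wE v : word (a :: s) v = refl a (word s v) by rewrite word_cons.
rewrite (eq_map wE) /= word_prev // map_comp.
case: s => [|b s] in ch chs wE IH *.
  by rewrite /= addr0 refl_self big_seq1.
rewrite IH // map_rcons /= endD refl_self.
rewrite [refl a b]reflE (A_chain_head2 ch).2 scaleN1r opprK addrCA addNr addr0.
congr (b :: _); rewrite endN refl_prev_total // mulr1n [in RHS]big_cons addrC.
congr rcons; apply: map_id_in => x xs.
by rewrite refl_fix // ipC (A_chain_orth ch).
Qed.

(** The longest element of the Weyl group of a chain acts by minus the flip of
    the diagram. It is built one node at a time; the image of a neighbour of
    the chain is what the next step needs. *)
Lemma chain_flip s : A_chain s -> exists u : 'End(V),
  [/\ group [fset x in s]%fset u, map u s = map -%R (rev s) &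
      forall a, A_chain (a :: s) -> u a = a + total s].
Proof.
elim: s => [_|b s IH ch].
  exists \1%VF; split=> //; first exact: group1.
  by move=> a _; rewrite id_lfunE big_nil addr0.
have [u [gu us ub]] := IH (A_chain_behead ch).
have gw : group [fset x in b :: s]%fset (word (b :: s)).
  by apply: group_word => x; rewrite !inE.
have [c [gc wK cK]] := groupV gw.
have cycle := word_cycle ch isT.
exists (c \o u)%VF; split.
- apply: groupM => //; apply: groupS gu => x; rewrite !inE => ->; exact: orbT.
- have : map u (b :: s) = map (word (b :: s)) (map -%R (rev (b :: s))).
    rewrite -map_comp (eq_map (fun x => endN (word (b :: s)) x)).
    rewrite (map_comp -%R (word (b :: s))) map_rev cycle /= rev_rcons /= opprK.
    by rewrite us ub // big_cons.
  move=> e; have -> : map (c \o u)%VF (b :: s) = map c (map u (b :: s)).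
    by rewrite -map_comp; apply: eq_map => x; rewrite comp_lfunE.
  by rewrite e -map_comp map_id_in // => x _; exact: wK.
- move=> a cha; rewrite comp_lfunE (group_fix _ gu); last first.
    by move=> x; rewrite !inE; apply: A_chain_orth cha.
  apply: (can_inj wK); rewrite cK endD word_prev //= end_sum.
  have -> : \sum_(i <- b :: s) word (b :: s) i =
      \sum_(x <- map (word (b :: s)) (b :: s)) x.
    by rewrite big_map.
  rewrite cycle -cats1 big_cat big_seq1 /= big_cons -addrA [b + (_ + _)]addrA.
  by rewrite subrr addr0.
Qed.

End Chains.

(** * Simple systems *)

Section SimpleSystem.
Variables (R : realType) (V : vectType R) (ip : {dot V for idfun}).
Variables (Phi Pi : {fset V}).
Hypotheses (rootPhi : is_root_system ip Phi) (simplePi : is_simple_system Phi Pi).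
Implicit Types (a b g u v : V) (s t : seq V) (w : 'End(V)) (A B J K : {fset V}).

Local Notation refl := (refl ip).
Local Notation coroot := (coroot ip).
Local Notation word := (refl_word ip).
Local Notation group := (refl_group ip).

(** The coefficient of the simple root [a] in [v]. Reading it off the tuple of
    simple roots makes it linear on the whole space, not only on their span. *)
Definition scoord a v : R :=
  \sum_(i < size Pi | Pi`_i == a) coord (in_tuple Pi) i v.

Definition pos v : Prop := {in Pi, forall a, 0 <= scoord a v}.

(** Membership in the span of [J], for vectors in the span of the simple
    roots. *)
Definition supported J v : Prop := {in Pi, forall a, a \notin J -> scoord a v = 0}.

Definition dom J v : Prop := {in J, forall g, 0 <= ip v g}.

Lemma root_neq0 a : a \in Phi -> a != 0.
Proof. by case: rootPhi => h _ _ aPhi; apply: contraNneq h => <-. Qed.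

Lemma refl_root a b : a \in Phi -> b \in Phi -> refl a b \in Phi.
Proof. by case: rootPhi => _ h _ aP bP; apply: h. Qed.

Lemma rootN a : a \in Phi -> - a \in Phi.
Proof. by move=> aP; rewrite -(refl_self ip) refl_root. Qed.

Lemma simple_root a : a \in Pi -> a \in Phi.
Proof. by case: simplePi => /fsubsetP h _ _ _ /h. Qed.

Lemma simple_neq0 a : a \in Pi -> a != 0.
Proof. by move=> /simple_root/root_neq0. Qed.

Lemma group_root A w v :
  {subset A <= Phi} -> group A w -> v \in Phi -> w v \in Phi.
Proof.
move=> AP; apply: (@group_stable _ _ ip A (fun x => x \in Phi)) => a x /AP.
exact: refl_root.
Qed.

Lemma scoordD a u v : scoord a (u + v) = scoord a u + scoord a v.
Proof. by rewrite /scoord -big_split; apply: eq_bigr => i _; rewrite linearD. Qed.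

Lemma scoordZ a (k : R) v : scoord a (k *: v) = k * scoord a v.
Proof. by rewrite /scoord big_distrr; apply: eq_bigr => i _; rewrite linearZ. Qed.

Lemma scoordN a v : scoord a (- v) = - scoord a v.
Proof. by rewrite -scaleN1r scoordZ mulN1r. Qed.

Lemma scoord0 a : scoord a 0 = 0.
Proof. by rewrite -(scale0r 0) scoordZ mul0r. Qed.

Lemma scoord_simple a b : a \in Pi -> b \in Pi -> scoord a b = (a == b)%:R.
Proof.
case: simplePi => _ fr _ _ aP bP.
have Hi : (index a Pi < size Pi)%N by rewrite index_mem.
have Hj : (index b Pi < size Pi)%N by rewrite index_mem.
rewrite /scoord (big_pred1 (Ordinal Hi)); last first.
  move=> k /=; rewrite -[RHS]val_eqE /=.
  by rewrite -{1}(nth_index 0 aP) nth_uniq ?free_uniq.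
have eb : b = (in_tuple Pi)`_(Ordinal Hj) by rewrite /= nth_index.
rewrite {1}eb coord_free // -val_eqE /=.
by rewrite -(inj_in_eq (@index_inj _ 0 Pi)) // eq_sym.
Qed.

Lemma scoord_sum a (I : Type) (r : seq I) (P : pred I) (F : I -> V) :
  scoord a (\sum_(i <- r | P i) F i) = \sum_(i <- r | P i) scoord a (F i).
Proof. by apply: (big_morph (scoord a)); [exact: scoordD | exact: scoord0]. Qed.

Lemma scoord_lincomb a (c : V -> R) : a \in Pi ->
  scoord a (\sum_(b <- Pi) c b *: b) = c a.
Proof.
move=> aP; rewrite scoord_sum (big_rem a) //= scoordZ scoord_simple // eqxx mulr1.
rewrite big_seq big1 ?addr0 // => b.
have [_ /free_uniq uP _ _] := simplePi.
rewrite mem_rem_uniq // inE => /andP[ba bP].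
by rewrite scoordZ scoord_simple // eq_sym (negbTE ba) mulr0.
Qed.

Lemma root_sign v : v \in Phi -> pos v \/ pos (- v).
Proof.
have [_ _ e _] := simplePi; move=> vP.
have : [set` Phi] v by [].
rewrite e => -[[_ [c c0 ->]]|[u [_ [c c0 ->]] <-]]; [left|right];
  by move=> a aP; rewrite ?opprK scoord_lincomb // c0.
Qed.

Lemma root_lincomb v : v \in Phi -> v = \sum_(a <- Pi) scoord a v *: a.
Proof.
have [_ _ e _] := simplePi; move=> vP.
have : [set` Phi] v by [].
have lc c : \sum_(b <- Pi) c b *: b =
    \sum_(a <- Pi) scoord a (\sum_(b <- Pi) c b *: b) *: a.
  by rewrite [LHS]big_seq [RHS]big_seq; apply: eq_bigr => a aP; rewrite scoord_lincomb.
rewrite e => -[[_ [c c0 ->]]|[u [_ [c c0 ->]] <-]]; first exact: lc.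
by rewrite {1}lc -sumrN; apply: eq_bigr => a _; rewrite scoordN scaleNr.
Qed.

Lemma not_pos_neg v : v \in Phi -> pos v -> ~ pos (- v).
Proof.
move=> vP pv nv; have /eqP := root_neq0 vP; apply.
rewrite (root_lincomb vP) big_seq big1 // => a aP.
have -> : scoord a v = 0; last by rewrite scale0r.
by have := pv a aP; have := nv a aP; rewrite scoordN; lra.
Qed.

Lemma pos_coord v a : v \in Phi -> a \in Pi -> 0 < scoord a v -> pos v.
Proof.
move=> vP aP h; case: (root_sign vP) => // /(_ a aP); rewrite scoordN; lra.
Qed.

Lemma simple_pos a : a \in Pi -> pos a.
Proof. by move=> aP b bP; rewrite scoord_simple // ler0n. Qed.

Lemma scoord_refl a b v : a \in Pi -> b \in Pi -> b != a ->
  scoord b (refl a v) = scoord b v.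
Proof.
move=> aP bP ba.
rewrite reflE scoordD scoordN scoordZ (scoord_simple bP aP) (negbTE ba).
by rewrite mulr0 subr0.
Qed.

Lemma pos_other_coord a g : a \in Pi -> g \in Phi -> pos g -> g != a ->
  exists b, [/\ b \in Pi, b != a & 0 < scoord b g].
Proof.
move=> aP gP pg ga; apply: contrapT => h.
have gE : g = scoord a g *: a.
  rewrite {1}(root_lincomb gP) (big_rem a) //= big_seq big1 ?addr0 // => b.
  have [_ /free_uniq uP _ _] := simplePi.
  rewrite mem_rem_uniq // inE => /andP[ba bP].
  have [->|b0] := eqVneq (scoord b g) 0; first by rewrite scale0r.
  by case: h; exists b; split=> //; rewrite lt_def b0 pg.
case: rootPhi => _ _ /(_ a (simple_root aP) (scoord a g)).
rewrite -gE => /(_ gP) [] e; first by case/eqP: ga; rewrite gE e scale1r.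
by have := pg a aP; rewrite e; lra.
Qed.

(** A second simple root occurs in [g], and [refl a] does not change its
    coefficient, so the image is positive too. *)
Lemma simple_refl_pos a g : a \in Pi -> g \in Phi -> pos g -> g != a ->
  pos (refl a g).
Proof.
move=> aP gP pg ga.
have [b [bP ba b0]] := pos_other_coord aP gP pg ga.
apply: (pos_coord _ bP); first by rewrite refl_root // simple_root.
by rewrite scoord_refl.
Qed.

Lemma simple_obtuse a b : a \in Pi -> b \in Pi -> a != b -> ip a b <= 0.
Proof.
move=> aP bP ab; rewrite leNgt; apply/negP => h.
have rP : refl a b \in Phi by rewrite refl_root // simple_root.
have pr : pos (refl a b).
  apply: (pos_coord rP bP).
  by rewrite scoord_refl // 1?eq_sym // scoord_simple // eqxx ltr01.
have := pr a aP; rewrite reflE scoordD scoordN scoordZ !scoord_simple // eqxx.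
rewrite (negbTE ab) mulr1 sub0r oppr_ge0 leNgt pair_gt0 ?simple_neq0 //.
by rewrite ipC h.
Qed.

Lemma word_root s v : {subset s <= Pi} -> v \in Phi -> word s v \in Phi.
Proof.
move=> sP; apply: (@group_root Pi) => [a|]; first exact: simple_root.
exact: group_word.
Qed.

(** Reading the word from the right, [g] starts positive and ends negative.
    The letter at which its image changes sign is that image, by
    [simple_refl_pos], so this letter can be deleted at the cost of a
    reflection in [g] on the right. *)
Lemma exchange s g : {subset s <= Pi} -> g \in Pi -> pos (- word s g) ->
  exists t, [/\ {subset t <= s}, (size t).+1 = size s &
                forall v, word t v = word s (refl g v)].
Proof.
elim: s => [|a s IH] sP gP; rewrite ?word_nil ?word_cons => neg.
  by case: (not_pos_neg (simple_root gP) (simple_pos gP)).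
have [aP {}sP] := sub_cons sP.
have sg : word s g \in Phi by rewrite word_root // simple_root.
case: (root_sign sg) => [psg|/(IH sP gP)[t [ts st tE]]]; last first.
  exists (a :: t); split=> [x||v]; last by rewrite !word_cons tE.
    by rewrite !inE => /orP[->|/ts ->] //; rewrite orbT.
  by rewrite /= st.
have sga : word s g = a.
  apply/eqP; apply: contraT => h.
  by case: (not_pos_neg (refl_root (simple_root aP) sg)) => //; apply: simple_refl_pos.
exists s; split=> // [x|v]; first by rewrite inE orbC => ->.
by rewrite word_cons -(group_refl_conj _ _ (group_word ip sP)) sga reflK.
Qed.

Lemma supported_refl J a v : a \in Pi -> a \in J -> supported J v ->
  supported J (refl a v).
Proof.
move=> aP aJ h b bP bJ; rewrite scoord_refl // ?h //.
by apply: contraNneq bJ => ->.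
Qed.

Lemma supported_group J w v : {subset J <= Pi} -> group J w -> supported J v ->
  supported J (w v).
Proof.
move=> JP; apply: (@group_stable _ _ ip J (supported J)) => a x aJ.
by apply: supported_refl => //; apply: JP.
Qed.

Lemma supported_simple J a : a \in Pi -> a \in J -> supported J a.
Proof.
move=> aP aJ b bP bJ; rewrite scoord_simple // [b == a](_ : _ = false) //.
by apply: contraNF bJ => /eqP ->.
Qed.

Lemma supportedN J v : supported J v -> supported J (- v).
Proof. by move=> h a aP aJ; rewrite scoordN h // oppr0. Qed.

Lemma dom_pos J v d : dom J v -> d \in Phi -> supported J d -> pos d ->
  0 <= ip v d.
Proof.
move=> vJ dP dJ pd; rewrite ipC (root_lincomb dP) ip_suml big_seq.
apply: sumr_ge0 => a aP; rewrite ipZl ipC.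
have [aJ|aJ] := boolP (a \in J); first by rewrite mulr_ge0 ?pd ?vJ.
by rewrite dJ // mul0r.
Qed.

(** Chambers are fundamental domains, and stabilisers of dominant vectors are
    parabolic. Each step shortens the word with [exchange]: a last letter that
    the word does not make negative is redundant, and one that it does make
    negative must fix [v]. *)
Lemma dom_stab J w v : {subset J <= Pi} -> group J w -> dom J v -> dom J (w v) ->
  w v = v /\ group [fset g in J | ip v g == 0]%fset w.
Proof.
move=> JP [s sJ ->] vJ.
have [n] := ubnP (size s); elim: n => // n IH in s sJ *.
case/lastP: s => [|t g] in sJ *.
  by move=> _ _; rewrite word_nil; split=> //; exists [::].
rewrite size_rcons !ltnS => st wvJ.
have [gJ tJ] : g \in J /\ {subset t <= J}.
  by split=> [|x xt]; apply: sJ; rewrite mem_rcons inE ?eqxx // xt orbT.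
have gP := JP _ gJ.
have tP : {subset t <= Pi} by move=> x /tJ /JP.
have sP : {subset rcons t g <= Pi} by move=> x /sJ /JP.
have wgP : word (rcons t g) g \in Phi by rewrite word_root // simple_root.
case: (root_sign wgP) => [pw|nw].
  have [|r [rt sr rE]] := exchange tP gP.
    by rewrite -endN -(refl_self ip) -word_rcons.
  have wE : word (rcons t g) = word r by apply/lfunP => x; rewrite rE word_rcons.
  move: wvJ; rewrite wE => wvJ.
  apply: IH wvJ => [x /rt /tJ //|]; lia.
have [r [rt sr rE]] := exchange sP gP nw.
have vg : ip v g = 0.
  apply/eqP; rewrite eq_le vJ // andbT.
  have := dom_pos wvJ (rootN wgP) _ nw.
  rewrite ipNr word_isom oppr_ge0; apply; apply: supportedN.
  by apply: supported_group (group_word _ sJ) _ => //; apply: supported_simple.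
have wE v' : word (rcons t g) v' = word r (refl g v').
  by rewrite rE reflK.
have rv : word r v = word (rcons t g) v by rewrite wE refl_fix.
rewrite -rv in wvJ *.
have rJ : {subset r <= J} by move=> x /rt /sJ.
have [|-> gr] := IH r rJ _ wvJ; first by move: sr; rewrite size_rcons; lia.
split=> //; have -> : word (rcons t g) = (word r \o refl g)%VF.
  by apply/lfunP => x; rewrite comp_lfunE wE.
by apply: groupM => //; apply: group_refl; rewrite !inE gJ vg eqxx.
Qed.

(** * Heights *)

Definition height v : R := \sum_(a <- Pi) scoord a v.

Lemma height_refl a v : a \in Pi -> height (refl a v) = height v - ip v (coroot a).
Proof.
move=> aP; rewrite /height (big_rem a) //= [in RHS](big_rem a) //=.
rewrite [X in _ + X](_ : _ = \sum_(b <- rem a Pi) scoord b v).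
  by rewrite reflE scoordD scoordN scoordZ (scoord_simple aP aP) eqxx mulr1 addrAC.
rewrite big_seq [RHS]big_seq; apply: eq_bigr => b.
have [_ /free_uniq uP _ _] := simplePi.
by rewrite mem_rem_uniq // inE => /andP[ba bP]; rewrite scoord_refl.
Qed.

(** The orbit is finite; a member of maximal height is dominant, because a
    simple reflection that pairs negatively with a root raises its height. *)
Lemma dom_conj J v : {subset J <= Pi} -> v \in Phi ->
  exists2 w, group J w & dom J (w v).
Proof.
move=> JP vP.
have [|x [xP [w gw xE] xmax]] := @seq_argmax _ _ Phi
    (fun x => exists2 w, group J w & x = w v) height v vP.
  by exists \1%VF; [exact: group1 | rewrite id_lfunE].
exists w => // g gJ; rewrite -xE leNgt; apply/negP => xg.
have gP := JP _ gJ.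
have := xmax (refl g x); rewrite refl_root ?(simple_root gP) // height_refl //.
have -> : (height x - ip x (coroot g) <= height x) = false.
  by apply/negbTE; rewrite -ltNge ltrDl oppr_gt0 ltNge pair_ge0 ?simple_neq0 // -ltNge.
move=> /(_ isT) h; suff : false by []; apply: h.
exists (refl g \o w)%VF; last by rewrite comp_lfunE xE.
by apply: groupM => //; apply: group_refl.
Qed.

(** Every positive root is reached from a simple root by simple reflections
    through positive roots. A counterexample of minimal height pairs positively
    with some simple root, and reflecting in it lowers the height. *)
Lemma pos_root_ind (P : V -> Prop) :
  {in Pi, forall a, P a} ->
  (forall a g, a \in Pi -> g \in Phi -> pos g -> P g -> P (refl a g)) ->
  forall g, g \in Phi -> pos g -> P g.
Proof.
move=> Ps Pr g0 g0P pg0; apply: contrapT => nPg0.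
have [|g [gP [pg nPg] gmin]] := @seq_argmax _ _ Phi
    (fun x => pos x /\ ~ P x) (fun x => - height x) g0 g0P; first by [].
have [a aP ga] : exists2 a, a \in Pi & 0 < ip g a.
  apply: contrapT => h; have := ip_gt0 ip (root_neq0 gP); apply/negP.
  rewrite -leNgt {1}(root_lincomb gP) ip_suml big_seq.
  apply: sumr_le0 => a aP; rewrite ipZl mulr_ge0_le0 ?pg //.
  by rewrite leNgt ipC; apply/negP => ?; apply: h; exists a.
have [e|nga] := eqVneq g a; first by case: nPg; rewrite e; apply: Ps.
have rP : refl a g \in Phi by rewrite refl_root // simple_root.
have pr := simple_refl_pos aP gP pg nga.
have Prg : P (refl a g).
  apply: contrapT => nPr; have := gmin _ rP (conj pr nPr).
  have : 0 < ip g (coroot a) by rewrite pair_gt0 // simple_neq0.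
  by rewrite height_refl //; lra.
by apply: nPg; rewrite -(reflK ip a g); apply: Pr.
Qed.

Lemma refl_refl a g : refl (refl a g) = (refl a \o (refl g \o refl a))%VF.
Proof.
apply/lfunP => v; rewrite !comp_lfunE -{1}(reflK ip a v).
have aA : a \in [fset a]%fset by rewrite inE.
exact: group_refl_conj (group_refl ip aA).
Qed.

Lemma refl_group_simple w : group Phi w -> group Pi w.
Proof.
have rP g : g \in Phi -> group Pi (refl g).
  have H : forall g, g \in Phi -> pos g -> group Pi (refl g).
    apply: pos_root_ind => [a|a h aP hP ph IH]; first exact: group_refl.
    by rewrite refl_refl; do !apply: groupM => //; apply: group_refl.
  by move=> gP; case: (root_sign gP) => [/(H _ gP)//|/(H _ (rootN gP))]; rewrite reflN.
move=> [s sP ->]; elim: s sP => [_|a s IH /sub_cons[aP sP]]; first exact: group1.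
by apply: groupM; [exact: rP | exact: IH].
Qed.

Lemma simple_sub : {subset Pi <= Phi}.
Proof. exact: simple_root. Qed.

Hypothesis crystPhi : crystallographic ip Phi.

Lemma scoord_int v a : v \in Phi -> a \in Pi -> scoord a v \is a Num.int.
Proof.
move=> vP aP.
have H : forall g, g \in Phi -> pos g -> scoord a g \is a Num.int.
  apply: pos_root_ind => [b bP|b g bP gP pg IH].
    by rewrite scoord_simple // rpred_nat.
  have bPhi := simple_root bP.
  rewrite reflE scoordD scoordN scoordZ (scoord_simple aP bP).
  by rewrite rpredB ?rpredM ?rpred_nat ?crystPhi.
by case: (root_sign vP) => [/(H _ vP)//|/(H _ (rootN vP))]; rewrite scoordN rpredN.
Qed.

(** The numerical core. Conjugate [g] to a root [d] that is antidominant for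
    the simple roots orthogonal to [a]. As the pairing of [d] with [coroot a]
    is 1 and the coefficients of [d] are integers, [d = c + e] where [c] is
    simple and [e] is supported on the simple roots orthogonal to [a]; then
    [ip d e <= 0] gives [ip c c >= ip d d + ip e e], while
    [ip c c <= ip a a = ip d d], so that [e = 0]. *)
Lemma conj_to_simple J a g : {subset J <= Pi} -> a \in Phi -> dom J a ->
  g \in Phi -> supported J g -> ip g (coroot a) = 1 -> ip a (coroot g) = 1 ->
  exists2 w, group [fset h in J | ip a h == 0]%fset w & w g \in J.
Proof.
move=> JP aP aJ gP gJ ga ag; set K := [fset h in J | _]%fset.
have KJ : {subset K <= J} by move=> x; rewrite !inE => /andP[].
have KP : {subset K <= Pi} by move=> x /KJ /JP.
have [w gw] := dom_conj KP (rootN gP).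
set d := w g => dK.
have wa : w a = a.
  by apply: group_fix gw => h; rewrite !inE => /andP[_ /eqP].
have dP : d \in Phi by apply: (group_root _ gw gP) => x /KP /simple_root.
have dJ : supported J d by apply: supported_group (groupS KJ gw) gJ.
have da : ip d (coroot a) = 1 by rewrite -wa (group_pair _ _ gw).
have ad : ip a (coroot d) = 1 by rewrite -{1}wa (group_pair _ _ gw).
have a0 := root_neq0 aP; have d0 := root_neq0 dP.
have pd : pos d.
  case: (root_sign dP) => // nd.
  have := dom_pos aJ (rootN dP) (supportedN dJ) nd.
  rewrite ipNr oppr_ge0 ipC leNgt -pair_gt0 //.
  by rewrite da ltr01.
have term_ge0 h : h \in Pi -> 0 <= scoord h d * ip h (coroot a).
  move=> hP; have [hJ|hJ] := boolP (h \in J); last by rewrite dJ // mul0r.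
  by rewrite mulr_ge0 ?pd // pair_ge0 // ipC aJ.
have term_int h : h \in Pi -> scoord h d * ip h (coroot a) \is a Num.int.
  by move=> hP; rewrite rpredM ?scoord_int // crystPhi // simple_root.
have sum1 : \sum_(h <- Pi) scoord h d * ip h (coroot a) = 1.
  rewrite -da {2}(root_lincomb dP) ip_suml.
  by apply: eq_bigr => h _; rewrite ipZl.
have [c cP c0] : exists2 c, c \in Pi & 0 < scoord c d * ip c (coroot a).
  apply: contrapT => H; have := @ltr01 R; rewrite -sum1; apply/negP.
  rewrite -leNgt big_seq; apply: sumr_le0 => h hP.
  by rewrite leNgt; apply/negP => ?; apply: H; exists h.
have c1 := int_ge1 (term_int c cP) c0.
have rest0 h : h \in Pi -> h != c -> scoord h d * ip h (coroot a) = 0.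
  move=> hP hc; have [_ /free_uniq uP _ _] := simplePi.
  apply/eqP; rewrite eq_le term_ge0 // andbT.
  move: sum1; rewrite (big_rem c) //= (big_rem h) /=; last first.
    by rewrite mem_rem_uniq // inE hc.
  have : 0 <= \sum_(y <- rem h (rem c Pi)) scoord y d * ip y (coroot a).
    by rewrite big_seq; apply: sumr_ge0 => y /mem_rem/mem_rem; apply: term_ge0.
  by lra.
have sc0 : 0 < scoord c d.
  by rewrite lt_def pd // andbT; apply: contraTneq c0 => ->; rewrite mul0r ltxx.
have mc0 : 0 < ip c (coroot a) by rewrite -(pmulr_rgt0 _ sc0).
have cJ : c \in J by apply: contraTT sc0 => cJ; rewrite dJ // ltxx.
have sc1 := int_ge1 (scoord_int dP cP) sc0.
have mc1 := int_ge1 (crystPhi (simple_root cP) aP) mc0.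
have c_le1 : scoord c d * ip c (coroot a) <= 1.
  rewrite -sum1 (big_rem c) //= lerDl big_seq.
  by apply: sumr_ge0 => y /mem_rem; apply: term_ge0.
have [sc mc] : scoord c d = 1 /\ ip c (coroot a) = 1 by nra.
exists w => //; rewrite -/d.
set e := \sum_(h <- rem c Pi) scoord h d *: h.
have dE : d = c + e.
  by rewrite {1}(root_lincomb dP) (big_rem c) //= sc scale1r.
have de : ip d e <= 0.
  rewrite ipC ip_suml big_seq; apply: sumr_le0 => h.
  have [_ /free_uniq uP _ _] := simplePi.
  rewrite mem_rem_uniq // inE => /andP[hc hP]; rewrite ipZl.
  have [->|sh] := eqVneq (scoord h d) 0; first by rewrite mul0r.
  rewrite mulr_ge0_le0 ?pd //.
  have hK : h \in K.
    have hJ : h \in J by apply: contraNT sh => hJ; rewrite dJ.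
    move: (rest0 h hP hc) => /eqP; rewrite mulf_eq0 (negbTE sh) /= pair_eq0 //.
    by rewrite !inE hJ ipC.
  by have := dK h hK; rewrite endN ipNl oppr_ge0 ipC.
have cc : ip c c <= ip a a.
  have ac0 : 0 < ip a (coroot c).
    by rewrite pair_gt0 ?simple_neq0 // ipC -pair_gt0.
  have := int_ge1 (crystPhi aP (simple_root cP)) ac0.
  have := mc; rewrite !pairE (ipC _ a c) => E.
  have := ip_gt0 ip a0; have := ip_gt0 ip (simple_neq0 cP).
  move: E; move: (ip c c) (ip a a) (ip c a) => x y z E x0 y0.
  have -> : z = y / 2 by rewrite -[RHS]mulr1 -[X in _ = _ * X]E; field; rewrite gt_eqF.
  have -> : 2 / x * (y / 2) = y / x by field; rewrite gt_eqF.
  by rewrite ler_pdivlMr // mul1r.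
have aad : ip a a = ip d d.
  have := ad; rewrite -da !pairE (ipC _ a d) => /eqP.
  have ad0 : ip d a != 0 by rewrite -pair_eq0 // da oner_eq0.
  rewrite (inj_eq (mulIf ad0)) => /eqP /mulfI h.
  by apply/invr_inj; rewrite h // pnatr_eq0.
have e0 : e = 0.
  apply/eqP; apply: contraTT isT => /ip_gt0 - /(_ ip) e0.
  suff : ip c c = ip d d - 2 * ip d e + ip e e by rewrite -aad; lra.
  have -> : c = d - e by rewrite dE addrK.
  by rewrite !(ipDl, ipDr, ipNl, ipNr) (ipC _ e d); ring.
by rewrite dE e0 addr0.
Qed.

(** * Normal forms of chains *)

Local Notation perp J a := [fset h in J | ip a h == 0]%fset.

Lemma perp_sub J a : {subset perp J a <= J}.
Proof. by move=> x; rewrite !inE => /andP[]. Qed.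

(** All the terms of the pairing of [a] with [x] have the same sign, so they
    vanish one by one. *)
Lemma supported_perp J a x : dom J a -> x \in Phi -> supported J x ->
  ip a x = 0 -> supported (perp J a) x.
Proof.
move=> aJ xP xJ ax.
wlog px : x xP xJ ax / pos x => [H|].
  case: (root_sign xP) => [/H|px]; first exact.
  have := H _ (rootN xP) (supportedN xJ) _ px.
  rewrite ipNr ax oppr0 => /(_ erefl) h b bP bK.
  by rewrite -(opprK x) scoordN h // oppr0.
have ge0 h : h \in Pi -> 0 <= scoord h x * ip h a.
  move=> hP; have [hJ|hJ] := boolP (h \in J); last by rewrite xJ // mul0r.
  by rewrite mulr_ge0 ?px // ipC aJ.
move=> b bP; rewrite !inE negb_and => /orP[|ab]; first exact: xJ.
have sum0 : \sum_(h <- Pi) scoord h x * ip h a = 0.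
  transitivity (ip x a); last by rewrite ipC.
  rewrite [in RHS](root_lincomb xP) ip_suml.
  by apply: eq_bigr => h _; rewrite ipZl.
move: sum0; rewrite (big_rem b) //= => sum0.
have rest : 0 <= \sum_(y <- rem b Pi) scoord y x * ip y a.
  by rewrite big_seq; apply: sumr_ge0 => y /mem_rem; apply: ge0.
have /eqP : scoord b x * ip b a = 0 by have := ge0 b bP; lra.
by rewrite mulf_eq0 [ip b a]ipC (negbTE ab) orbF => /eqP.
Qed.

Lemma opp_simple_dom J g : {subset J <= Pi} -> g \in Pi -> g \notin J ->
  dom J (- g).
Proof.
move=> JP gP gJ h hJ; rewrite ipNl oppr_ge0.
apply: simple_obtuse => //; first exact: JP.
by apply: contraNneq gJ => ->.
Qed.

(** The reflections in [J] fix the entries before [a], the last entry that is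
    already normalised. The opposite of the next entry is moved to a simple root
    by reflections that fix [a]. The rest of the chain is orthogonal to [a],
    hence stays in the span of the roots of [J] orthogonal to [a], and the
    argument repeats with these roots. *)
Lemma A_chain_normalize J a t : {subset J <= Pi} -> a \in Phi -> dom J a ->
  {in t, forall x, x \in Phi /\ supported J x} -> A_chain ip (a :: t) ->
  exists w : 'End(V), group (perp J a) w /\ {in t, forall x, - w x \in J}.
Proof.
have [n] := ubnP (size t); elim: n => // n IH in t J a *.
case: t => [|g t] /=; rewrite ltnS => tn JP aP aJ tJ ch.
  by exists \1%VF; split=> //; exact: group1.
have [gP gJ] := tJ g (mem_head _ _).
have [ag ga] := A_chain_head2 ch.
have [||w1 gw1 w1g] := conj_to_simple JP aP aJ (rootN gP) (supportedN gJ).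
- by rewrite ipNl ga opprK.
- by rewrite corootN ipNr ag opprK.
have KJ := @perp_sub J a; set K := perp J a in KJ gw1 *.
have KP : {subset K <= Pi} by move=> x /KJ /JP.
have KPhi : {subset K <= Phi} by move=> x /KP /simple_root.
have w1a : w1 a = a by apply: group_fix gw1 => h; rewrite !inE => /andP[_ /eqP].
have chw := A_chain_group gw1 ch.
have a0 := root_neq0 aP.
have w1gK : - w1 g \notin K.
  rewrite !inE -endN w1g /= -w1a (group_isom _ _ gw1) ipNr oppr_eq0 ipC.
  by rewrite -(pair_eq0 ip) // ga oppr_eq0 oner_eq0.
have [||||||w2 [gw2 w2t]] := IH (map w1 t) K (w1 g); rewrite ?size_map //.
- by rewrite (group_root KPhi gw1).
- by rewrite -[w1 g]opprK; apply: opp_simple_dom; rewrite // JP // -endN.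
- move=> _ /mapP[x xt ->]; have [|xP xJ] := tJ x; first by rewrite inE xt orbT.
  split; first by rewrite (group_root KPhi gw1).
  apply: (supported_group KP gw1); apply: supported_perp => //.
  exact: A_chain_orth ch xt.
- exact: A_chain_behead chw.
have w2K := groupS (@perp_sub K (w1 g)) gw2.
exists (w2 \o w1)%VF; split; first exact: groupM.
move=> x; rewrite comp_lfunE inE => /orP[/eqP ->|xt].
  rewrite (group_fix _ gw2) -?endN // => h; rewrite !inE => /andP[_ /eqP ->] //.
by apply: KJ; apply: w2t; apply: map_f.
Qed.

(** An element fixing [a] lies in the group generated by the roots of [J]
    orthogonal to [a]; it cannot change the coefficient of any other simple
    root, in particular that of the opposite of the next entry. *)
Lemma A_chain_normal_uniq J a t t' w : {subset J <= Pi} -> dom J a ->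
  {in t, forall x, - x \in J} -> {in t', forall x, - x \in J} ->
  A_chain ip (a :: t) -> A_chain ip (a :: t') ->
  group J w -> w a = a -> map w t = t' -> t = t'.
Proof.
elim: t t' J a => [|g t IH] t' J a JP aJ tJ t'J ch ch' gw wa; first by move=> <-.
move=> tE.
have waJ : dom J (w a) by rewrite wa.
have [_ gwK] := dom_stab JP gw aJ waJ.
case: t' => // g' t' in tE t'J ch' *; case: tE => wg wt.
have KJ := @perp_sub J a; set K := perp J a in KJ gwK.
have KP : {subset K <= Pi} by move=> x /KJ /JP.
have gJ : - g \in J by apply: tJ; rewrite mem_head.
have g'J : - g' \in J by apply: t'J; rewrite mem_head.
have gK : - g \notin K.
  rewrite !inE gJ /= ipNr oppr_eq0 ipC.
  have a0 : a != 0 by apply: (A_chain_neq0 ch); rewrite mem_head.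
  by rewrite -(pair_eq0 ip _ a0) (A_chain_head2 ch).2 oppr_eq0 oner_eq0.
(* [w] only adds combinations of roots of [K] to [- g]. *)
have eg : g = g'.
  have : scoord (- g) (w (- g)) = 1.
    pose P x := scoord (- g) x = 1.
    apply: (@group_stable _ _ ip K P w _ _ gwK) => [h x hK|]; rewrite /P.
      rewrite scoord_refl ?(JP _ gJ) ?KP //.
      by apply: contraNneq gK => ->.
    by rewrite scoord_simple ?(JP _ gJ) // eqxx.
  rewrite endN wg scoord_simple ?(JP _ gJ) ?(JP _ g'J) //.
  by case: eqP => [/oppr_inj|_ /eqP]; rewrite // eq_sym oner_eq0.
rewrite -eg in wg ch' *; congr (_ :: _).
have inK s : {in s, forall x, - x \in J} -> {in s, forall x, ip a x = 0} ->
    {in s, forall x, - x \in K}.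
  by move=> sJ sa x xs; rewrite !inE sJ //= ipNr sa // oppr0.
apply: (IH t' K g) => //.
- by rewrite -[g]opprK; apply: opp_simple_dom; rewrite // JP.
- apply: inK => x xt; first by apply: tJ; rewrite inE xt orbT.
  exact: A_chain_orth ch xt.
- apply: inK => x xt; first by apply: t'J; rewrite inE xt orbT.
  exact: A_chain_orth ch' xt.
- exact: A_chain_behead ch.
- exact: A_chain_behead ch'.
Qed.

(** As [dominant] forces the head to be a root, hence nonzero, the empty list,
    whose default head is 0, is excluded. *)
Definition normal s : Prop :=
  [/\ A_chain ip s, dominant ip Phi Pi (head 0 s) &
      {in behead s, forall x, - x \in Pi}].

Lemma root_supported x : supported Pi x.
Proof. by move=> b ->. Qed.

Lemma normal_exists s : s != [::] -> {subset s <= Phi} -> A_chain ip s ->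
  exists2 w : 'End(V), group Pi w & normal (map w s).
Proof.
case: s => // a t _ /sub_cons[aP tP] ch.
have [w1 gw1 w1a] := dom_conj (fun x => id) aP.
have w1P x : x \in Phi -> w1 x \in Phi by apply: group_root gw1; exact: simple_sub.
have [||||w2 [gw2 w2t]] := @A_chain_normalize Pi (w1 a) (map w1 t) (fun x => id).
- exact: w1P.
- exact: w1a.
- by move=> _ /mapP[x xt ->]; split; [apply/w1P/tP | exact: root_supported].
- exact: A_chain_group gw1 ch.
have w2a : w2 (w1 a) = w1 a.
  by apply: group_fix gw2 => h; rewrite !inE => /andP[_ /eqP].
have gw : group Pi (w2 \o w1)%VF.
  by apply: groupM gw1; apply: groupS gw2; apply: perp_sub.
exists (w2 \o w1)%VF => //; split.
- exact: A_chain_group gw ch.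
- by rewrite /= comp_lfunE w2a; split; [exact: w1P | exact: w1a].
- by move=> _ /mapP[x xt ->]; rewrite comp_lfunE w2t // map_f.
Qed.

Lemma normal_uniq p p' w : normal p -> normal p' -> group Pi w -> map w p = p' ->
  p = p'.
Proof.
case: p => [|a t]; first by move=> _ _ _ <-.
case: p' => // a' t' [ch [aP aD] tP] [ch' [aP' aD'] tP'] gw [wa wt].
have waD : dom Pi (w a) by rewrite wa.
have [wa' _] := @dom_stab Pi w a (fun x => id) gw aD waD.
have ea : a = a' by rewrite -wa wa'.
rewrite -ea in wa ch' *; congr (_ :: _).
exact: (@A_chain_normal_uniq Pi a t t' w).
Qed.

(** * The longest element *)

(** A last letter whose image under the word is positive is redundant by
    [exchange], so a word of minimal length is empty. *)
Lemma group_pos_id w : group Pi w -> {in Pi, forall g, pos (w g)} -> w = \1%VF.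
Proof.
move=> [s sP ->]; have [n] := ubnP (size s); elim: n => // n IH in s sP *.
case/lastP: s => [//|t g] in sP *.
rewrite size_rcons ltnS => tn wpos.
have gP : g \in Pi by apply: sP; rewrite mem_rcons mem_head.
have tP : {subset t <= Pi} by move=> x xt; apply: sP; rewrite mem_rcons inE xt orbT.
have [|r [rt sr rE]] := exchange tP gP.
  by rewrite -endN -(refl_self ip) -word_rcons; apply: wpos.
have wE : word (rcons t g) = word r by apply/lfunP => x; rewrite rE word_rcons.
rewrite wE in wpos *; apply: IH wpos; first by move=> x /rt /tP.
by rewrite -ltnS sr ltnS ltnW.
Qed.

Variable w0 : 'End(V).
Hypothesis longest_w0 : is_longest ip Phi Pi w0.

Lemma longest_group : group Pi w0.
Proof. by case: longest_w0 => /refl_group_simple. Qed.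

Lemma length_exists w : group Pi w -> exists k, is_length ip Pi w k.
Proof.
move=> [s sP wE].
pose Q m := `[< exists t, [/\ {subset t <= Pi}, size t = m & w = word t] >].
have exQ : exists m, Q m by exists (size s); apply/asboolP; exists s.
exists (ex_minn exQ); case: ex_minnP => m /asboolP mQ mmin; split=> // t tP tE.
by apply: mmin; apply/asboolP; exists t.
Qed.

(** Otherwise [w0 \o refl g] would be longer than [w0]: by [exchange], a word
    for it can be shortened into a word for [w0]. *)
Lemma longest_simple_neg g : g \in Pi -> pos (- w0 g).
Proof.
move=> gP; have [_ [k [_ kmin] kmax]] := longest_w0.
have wgP : w0 g \in Phi by rewrite (group_root simple_sub longest_group) // simple_root.
case: (root_sign wgP) => // pw.
have gu : group Pi (w0 \o refl g)%VF by apply: groupM longest_group (group_refl ip gP).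
have [l ll] := length_exists gu.
have gu' : group Phi (w0 \o refl g)%VF by apply: groupS gu; exact: simple_sub.
have lk := kmax _ _ gu' ll.
have [[t [tP st tE]] _] := ll.
have [|r [rt sr rE]] := exchange tP gP.
  by rewrite -tE comp_lfunE refl_self endN opprK.
have := kmin r _ _; rewrite leqNgt => /(_ (fun x h => tP _ (rt _ h))) H.
suff : false by []; apply: contraTT lk => _; rewrite -ltnNge.
have : w0 = word r by apply/lfunP => x; rewrite rE -tE comp_lfunE reflK.
by move=> /H; rewrite -ltnNge ltnS -st -sr ltnS.
Qed.

Lemma longest_neg v : v \in Phi -> pos v -> pos (- w0 v).
Proof.
move=> vP pv a aP; rewrite (root_lincomb vP) end_sum -sumrN scoord_sum big_seq.
apply: sumr_ge0 => b bP; rewrite endZ -scalerN scoordZ mulr_ge0 ?pv //.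
exact: longest_simple_neg.
Qed.

Lemma longestK v : w0 (w0 v) = v.
Proof.
have gw := longest_group.
have gww : group Pi (w0 \o w0)%VF by apply: groupM.
rewrite -comp_lfunE (group_pos_id gww) ?id_lfunE //.
move=> g gP; rewrite comp_lfunE -[w0 g]opprK endN.
apply: longest_neg; last exact: longest_simple_neg.
by rewrite rootN // (group_root simple_sub gw) // simple_root.
Qed.

Lemma rho_root v : v \in Phi -> - w0 v \in Phi.
Proof. by move=> vP; rewrite rootN // (group_root simple_sub longest_group). Qed.

(** The involution [- w0] keeps positive roots positive, so it preserves
    indecomposability. *)
Lemma rho_simple g : g \in Pi -> - w0 g \in Pi.
Proof.
move=> gP; set d := - w0 g.
have gPhi := simple_root gP.
have dP : d \in Phi by apply: rho_root.
have pd : pos d by apply: longest_simple_neg.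
have [c cP dc] : exists2 c, c \in Pi & scoord c d != 0.
  apply: contrapT => h; have /eqP := root_neq0 dP; apply.
  rewrite (root_lincomb dP) big_seq big1 // => c cP.
  have [->|c0] := eqVneq (scoord c d) 0; first by rewrite scale0r.
  by case: h; exists c.
have rc := rho_root (simple_root cP); have prc := longest_simple_neg cP.
have gE : g = \sum_(a <- Pi) scoord a d *: (- w0 a).
  rewrite -{1}(longestK g) -[w0 g]opprK -/d endN {1}(root_lincomb dP) end_sum.
  by rewrite -sumrN; apply: eq_bigr => a _; rewrite endZ scalerN.
(* Otherwise [g] would involve another simple root. *)
suff e : - w0 c = g by rewrite /d -e endN longestK opprK.
apply/eqP; apply: contraT => ne.
have [b [bP bg b0]] := pos_other_coord gP rc prc ne.
have : scoord b g = 0 by rewrite scoord_simple // (negbTE bg).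
rewrite {1}gE scoord_sum (big_rem c) //= scoordZ => s0.
have dc0 : 0 < scoord c d by rewrite lt_def dc pd.
have : 0 <= \sum_(a <- rem c Pi) scoord b (scoord a d *: (- w0 a)).
  rewrite big_seq; apply: sumr_ge0 => a /mem_rem aP.
  by rewrite scoordZ mulr_ge0 ?pd // longest_simple_neg.
have := mulr_gt0 dc0 b0; lra.
Qed.

(** [- w0 b] is the image of [b] under [w0 \o refl b], and it is dominant too. *)
Lemma rho_dominant b : dominant ip Phi Pi b -> - w0 b = b.
Proof.
move=> [bP bD]; have gw := longest_group.
have gu : group Pi (w0 \o refl b)%VF.
  apply: groupM => //; apply: refl_group_simple; exact: group_refl.
have uE : (w0 \o refl b)%VF b = - w0 b by rewrite comp_lfunE refl_self endN.
have uD : dom Pi ((w0 \o refl b)%VF b).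
  move=> h hP; rewrite uE -(group_isom _ _ gw) endN longestK ipNl -ipNr.
  by apply: bD; apply: rho_simple.
by have [] := @dom_stab Pi _ b (fun x => id) gu bD uD; rewrite uE.
Qed.

Lemma rho_pair u v : ip (- w0 u) (coroot (- w0 v)) = ip u (coroot v).
Proof. by rewrite corootN ipNl ipNr opprK (group_pair _ _ longest_group). Qed.

Lemma normal_rho p : normal p -> normal (map (fun x => - w0 x) p).
Proof.
case: p => [//|b t] [ch bD tP]; split.
- by apply: A_chain_map ch => u v _ _; apply: rho_pair.
- by rewrite /= rho_dominant.
- by move=> _ /mapP[x xt ->]; rewrite -endN; apply: rho_simple; apply: tP.
Qed.

End SimpleSystem.

(** * Chains are simple subsystems *)

Section ChainSubsystem.
Variables (R : realType) (V : vectType R) (ip : {dot V for idfun}).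
Implicit Types (a b u v : V) (s : seq V) (w : 'End(V)) (Phi : {fset V}).

Local Notation refl := (refl ip).
Local Notation coroot := (coroot ip).
Local Notation group := (refl_group ip).

(** A multiple, by [size s + 1], of the fundamental weight of the first node of
    the chain; see [weight_pair]. *)
Fixpoint weight s : V :=
  if s is a :: t then weight t + (size s)%:R *: a else 0.

Lemma weight_prev a s : A_chain ip (a :: s) ->
  ip (weight s) (coroot a) = - (size s)%:R.
Proof.
move=> ch; case: s => [|b s] in ch *; first by rewrite ip0l oppr0.
have orth t : {in t, forall x, ip a x = 0} -> ip (weight t) a = 0.
  elim: t => [|x t IH] h /=; first by rewrite ip0l.
  rewrite ipDl ipZl (ipC _ x) h ?mem_head // mulr0 addr0 IH // => y yt.
  by rewrite h // inE yt orbT.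
rewrite /= ipDl ipZl (A_chain_head2 ch).2 pairE orth ?mulr0 ?add0r ?mulrN1 //.
by move=> x; apply: A_chain_orth ch.
Qed.

Lemma weight_pair s j : A_chain ip s -> (j < size s)%N ->
  ip (weight s) (coroot s`_j) = (size s).+1%:R *+ (j == 0)%N.
Proof.
elim: s j => // a s IH j ch sj /=; rewrite ipDl ipZl.
have chs := A_chain_behead ch.
case: j => [|j] /= in sj *.
  by rewrite weight_prev // (ch 0%N 0%N) // /cartan_entry /= -!natr1; ring.
rewrite IH // mulr0n; have := ch 0%N j.+1 isT sj; rewrite /= => ->.
by rewrite /cartan_entry /=; case: j sj => [|j] sj /=; rewrite -?natr1; ring.
Qed.

Definition eps s k : V := weight s - (size s).+1%:R *: \sum_(i < k) s`_i.

Lemma epsS s k : eps s k.+1 = eps s k - (size s).+1%:R *: s`_k.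
Proof. by rewrite /eps big_ord_recr /= scalerDr opprD addrA. Qed.

Lemma cartan_entryE i j : cartan_entry R i j =
  2 * (i == j)%:R - (i.+1 == j)%:R - (j.+1 == i)%:R.
Proof.
rewrite /cartan_entry; have [->|ij] := eqVneq i j.
  have -> : (j.+1 == j) = false by lia.
  by rewrite /= mulr1 !subr0.
have [e|_] := eqVneq i.+1 j; last by case: (j.+1 == i) => /=; ring.
have -> : (j.+1 == i) = false by lia.
by rewrite /=; ring.
Qed.

Lemma eps_pair s k j : A_chain ip s -> (k <= size s)%N -> (j < size s)%N ->
  ip (eps s k) (coroot s`_j) = (size s).+1%:R * ((j == k)%:R - (j.+1 == k)%:R).
Proof.
move=> ch sk sj; elim: k sk => [|k IH] sk.
  by rewrite /eps big_ord0 scaler0 subr0 weight_pair // subr0 mulr_natr.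
rewrite epsS ipDl ipNl ipZl IH 1?ltnW // ch // eqSS -mulrBr cartan_entryE.
by congr (_ * _); rewrite (eq_sym k j) (eq_sym k.+1 j); ring.
Qed.

(** The vectors [eps s k] behave as the [size s + 1] coordinate vectors on
    which the Weyl group of a chain acts as a symmetric group. *)
Lemma refl_eps s j k : A_chain ip s -> (j < size s)%N -> (k <= size s)%N ->
  refl s`_j (eps s k) =
  eps s (if k == j then j.+1 else if k == j.+1 then j else k).
Proof.
move=> ch sj sk; rewrite reflE eps_pair // (eq_sym j) (eq_sym j.+1).
have [->|kj] := eqVneq k j.
  rewrite [j == j.+1](_ : _ = false) ?subr0 ?mulr1; last lia.
  by rewrite epsS.
have [->|kj1] := eqVneq k j.+1; last by rewrite subr0 mulr0 scale0r subr0.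
by rewrite sub0r mulrN1 scaleNr opprK epsS subrK.
Qed.

Lemma group_eps s w k : A_chain ip s -> group [fset x in s]%fset w ->
  (k <= size s)%N -> exists2 l, (l <= size s)%N & w (eps s k) = eps s l.
Proof.
move=> ch gw sk.
pose P x := exists2 l, (l <= size s)%N & x = eps s l.
apply: (@group_stable _ _ ip [fset x in s]%fset P) gw _; last by exists k.
move=> a x; rewrite !inE => /(nthP 0)[j sj <-] [l sl ->].
rewrite refl_eps //; eexists; last by [].
by case: eqP => // _; case: eqP => // _; apply: ltnW.
Qed.

(** Partial sums of the vectors [eps s k] form, up to a common factor, a basis
    dual to the coroots. *)
Lemma A_chain_free s : A_chain ip s -> free s.
Proof.
move=> ch; suff: free (in_tuple s) by [].
apply/freeP => c c0 m.
pose v := \sum_(k < m.+1) eps s k.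
have vs (i : 'I_(size s)) :
    ip v (coroot s`_i) = (size s).+1%:R * (i == m)%:R.
  have vk n : (n <= size s)%N -> ip (\sum_(k < n) eps s k) (coroot s`_i) =
      (size s).+1%:R * (i.+1 == n)%:R.
    elim: n => [|n IH] sn; first by rewrite big_ord0 ip0l mulr0.
    rewrite big_ord_recr /= ipDl IH 1?ltnW // eps_pair // 1?ltnW //.
    by rewrite eqSS; ring.
  by rewrite vk // eqSS.
have : ip (\sum_i c i *: (in_tuple s)`_i) v = 0 by rewrite c0 ip0l.
rewrite ip_suml (bigD1 m) //= big1 ?addr0 => [|i im].
  rewrite ipZl => /eqP; rewrite mulf_eq0 ipC => /orP[/eqP //|].
  have sm0 : s`_m != 0 by apply: (A_chain_neq0 ch); rewrite mem_nth.
  by rewrite -pair_eq0 // vs eqxx mulr1 pnatr_eq0.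
have si0 : s`_i != 0 by apply: (A_chain_neq0 ch); rewrite mem_nth.
rewrite ipZl ipC [ip v _](_ : _ = 0) ?mulr0 //.
by apply/eqP; rewrite -pair_eq0 // vs (negbTE (im : i != m)) mulr0.
Qed.

Lemma nonneg_span0 A : nonneg_span A (0 : V).
Proof. by exists (fun=> 0) => // ; rewrite big1 // => a _; rewrite scale0r. Qed.

Lemma nonneg_spanD A u v : nonneg_span A u -> nonneg_span A v ->
  nonneg_span A (u + v).
Proof.
move=> [c c0 ->] [d d0 ->]; exists (fun a => c a + d a) => [a aA|].
  by rewrite addr_ge0 ?c0 ?d0.
by rewrite -big_split; apply: eq_bigr => a _; rewrite scalerDl.
Qed.

Lemma nonneg_span_mem A a : a \in A -> nonneg_span A a.
Proof.
move=> aA; exists (fun b => (b == a)%:R) => [b _|]; first exact: ler0n.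
rewrite (big_rem a) //= eqxx scale1r big_seq big1 ?addr0 // => b.
by rewrite (mem_rem_uniq _ (fset_uniq A)) inE => /andP[/negbTE -> _]; rewrite scale0r.
Qed.

(** The root [s`_k + ... + s`_(l - 1)]. *)
Definition segment s k l : V := (size s).+1%:R^-1 *: (eps s k - eps s l).

Lemma segmentS s k l : segment s k l.+1 = segment s k l + s`_l.
Proof.
rewrite /segment epsS opprB addrCA scalerDr scalerA mulVf ?pnatr_eq0 //.
by rewrite scale1r; apply: addrC.
Qed.

Lemma segmentxx s k : segment s k k = 0.
Proof. by rewrite /segment subrr scaler0. Qed.

Lemma segment_nonneg s k l : (k <= l <= size s)%N ->
  nonneg_span [fset x in s]%fset (segment s k l).
Proof.
move=> /andP[]; elim: l => [|l IH].
  by rewrite leqn0 => /eqP -> _; rewrite segmentxx; apply: nonneg_span0.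
rewrite leq_eqVlt => /orP[/eqP -> _|kl ls].
  by rewrite segmentxx; apply: nonneg_span0.
rewrite segmentS; apply: nonneg_spanD; first exact: IH (ltnW ls).
by apply: nonneg_span_mem; rewrite !inE mem_nth.
Qed.

Section InRootSystem.
Variable (Phi : {fset V}).
Hypothesis rootPhi : is_root_system ip Phi.

Lemma segment_root s k l : A_chain ip s -> {subset s <= Phi} ->
  (k < l <= size s)%N -> segment s k l \in Phi.
Proof.
move=> ch sP /andP[]; elim: l => // l IH.
rewrite ltnS leq_eqVlt => /orP[/eqP -> ls|kl ls].
  by rewrite segmentS segmentxx add0r sP // mem_nth.
have -> : segment s k l.+1 = refl s`_l (segment s k l).
  rewrite /segment endZ endB !refl_eps // ?(ltnW ls) ?eqxx //; last lia.
  rewrite [(k == l)](_ : _ = false); last lia.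
  by rewrite [(k == l.+1)](_ : _ = false) //; lia.
apply: (refl_root rootPhi); first by rewrite sP // mem_nth.
exact: IH (ltnW ls).
Qed.

(** A reflection in the group of the chain moves some [eps s k] to another
    [eps s l], hence its root is proportional to their difference. *)
Lemma A_chain_reflections s a : A_chain ip s -> {subset s <= Phi} ->
  a \in Phi -> group [fset x in s]%fset (refl a) ->
  exists k l, (k < l <= size s)%N /\ (a = segment s k l \/ a = - segment s k l).
Proof.
move=> ch sP aP ga; have a0 := root_neq0 rootPhi aP.
have n0 : (size s).+1%:R != 0 :> R by rewrite pnatr_eq0.
have [k sk ak] : exists2 k, (k <= size s)%N & ip (eps s k) (coroot a) != 0.
  apply: contrapT => h.
  have hk k : (k <= size s)%N -> ip (eps s k) a = 0.
    move=> sk; apply/eqP; rewrite -pair_eq0 //; apply: contraT => ?.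
    by case: h; exists k.
  have := refl_self ip a; rewrite (group_fix _ ga) => [/eqP|x].
    rewrite -addr_eq0 -mulr2n -scaler_nat scaler_eq0 pnatr_eq0 /=.
    by rewrite (negbTE a0).
  rewrite !inE => /(nthP 0)[i si <-]; apply/eqP.
  have : ip (eps s i.+1) a = 0 by apply: hk.
  rewrite epsS ipDl ipNl ipZl hk 1?ltnW // sub0r => /eqP.
  by rewrite oppr_eq0 mulf_eq0 (negbTE n0) ipC.
have [l sl lE] := group_eps ch ga sk.
have aE : ip (eps s k) (coroot a) *: a = eps s k - eps s l.
  by rewrite -lE reflE opprB addrC subrK.
have kl : k != l.
  apply: contraNneq ak => e; move/eqP: aE.
  by rewrite e subrr scaler_eq0 (negbTE a0) orbF -e.
pose c := (size s).+1%:R^-1 * ip (eps s k) (coroot a).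
have c0 : c != 0 by rewrite mulf_neq0 // invr_eq0.
have segE : segment s k l = c *: a by rewrite /segment -aE scalerA.
have segE' : segment s l k = (- c) *: a.
  by rewrite /segment -opprB -aE scalerN scalerA scaleNr.
have [_ _ red] := rootPhi.
move: kl; rewrite neq_ltn => /orP[kl|lk].
  have kls : (k < l <= size s)%N by rewrite kl.
  exists k, l; split=> //; have := red a aP c.
  rewrite -segE => /(_ (segment_root ch sP kls)).
  by case=> e; [left|right]; rewrite segE e ?scale1r // scaleN1r opprK.
have lks : (l < k <= size s)%N by rewrite lk.
exists l, k; split=> //; have := red a aP (- c).
rewrite -segE' => /(_ (segment_root ch sP lks)).
by case=> e; [left|right]; rewrite segE' e ?scale1r // scaleN1r opprK.
Qed.

Lemma A_chain_simple_system s : A_chain ip s -> {subset s <= Phi} ->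
  exists2 Psi, is_root_subsystem ip Phi Psi & is_simple_system Psi [fset x in s]%fset.
Proof.
move=> ch sP; set D := [fset x in s]%fset.
pose Psi := [fset a in Phi | `[< group D (refl a) >]]%fset.
have PsiP a : a \in Psi <-> a \in Phi /\ group D (refl a).
  by rewrite !inE /=; split=> [/andP[-> /asboolP]|[-> /asboolP]].
have DP : (D `<=` Phi)%fset by apply/fsubsetP => x; rewrite !inE; apply: sP.
have DPsi : (D `<=` Psi)%fset.
  apply/fsubsetP => x xD; apply/PsiP; split; first exact: (fsubsetP DP).
  exact: group_refl.
have fD : free D.
  rewrite (@perm_free _ _ _ s) ?A_chain_free //; apply: uniq_perm => [||x].
  - exact: fset_uniq.
  - exact: A_chain_uniq ch.
  - by rewrite !inE.
have PsiN a : a \in Psi -> - a \in Psi.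
  by move=> /PsiP[aP ga]; apply/PsiP; rewrite reflN (rootN rootPhi).
exists Psi; first by exists D.
split=> //.
- rewrite eqEsubset; split=> a /=.
    move=> aPsi; have /PsiP[aP ga] := aPsi.
    have [k [l [/andP[kl ls] [e|e]]]] := A_chain_reflections ch sP aP ga.
      left; split=> //; rewrite e; apply: segment_nonneg; rewrite ls ltnW //.
    right; exists (- a); last by rewrite opprK.
    split; first exact: PsiN.
    by rewrite e opprK; apply: segment_nonneg; rewrite ls ltnW.
  by case=> [[]//|[b [bPsi _] <-]]; apply: PsiN.
- rewrite -subset0 => a [[/PsiP[aP _] [c c0 cE]] [b [_ [d d0 dE]] bE]] /=.
  have /eqP := root_neq0 rootPhi aP; apply.
  have sum0 : \sum_(i < size D) (c D`_i + d D`_i) *: (in_tuple D)`_i = 0.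
    transitivity (\sum_(x <- D) (c x + d x) *: x).
      by rewrite (big_nth 0) big_mkord.
    under eq_bigr do rewrite scalerDl.
    by rewrite big_split /= -cE -dE -bE addNr.
  have /freeP /(_ _ sum0) H : free (in_tuple D) by [].
  rewrite cE (big_nth 0) big_mkord big1 // => i _.
  have Di : D`_i \in D by rewrite mem_nth.
  have -> : c D`_i = 0; last by rewrite scale0r.
  by have := H i; have := c0 _ Di; have := d0 _ Di; lra.
Qed.

End InRootSystem.
End ChainSubsystem.

(** * Diagrams and pairs *)

Section Diagrams.
Variables (R : realType) (V : vectType R) (ip : {dot V for idfun}).
Implicit Types (a b u v : V) (s : seq V) (w : 'End(V)) (Phi D : {fset V}).

Local Notation refl := (refl ip).
Local Notation coroot := (coroot ip).
Local Notation group := (refl_group ip).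

Lemma A_chain_enum n s : size s = n -> A_chain ip s ->
  injective (fun i : 'I_n => s`_i) /\
  [set` [fset x in s]%fset] = range (fun i : 'I_n => s`_i).
Proof.
move=> sn ch; split.
  move=> i j /(uniqP 0 (A_chain_uniq ch)); rewrite !inE sn !ltn_ord => /(_ isT isT).
  exact: val_inj.
rewrite eqEsubset; split=> x /=; rewrite !inE.
  by move=> /(nthP 0)[i si <-]; rewrite sn in si; exists (Ordinal si).
by move=> [i _ <-]; rewrite mem_nth // sn.
Qed.

Lemma cartan_type_chain n D : cartan_type_A ip n D <->
  exists s, [/\ size s = n, A_chain ip s & D = [fset x in s]%fset].
Proof.
split=> [[e [ei De /matrixP eM]]|[s [sn ch ->]]].
  have [s [sn sE ->]] := fset_of_ord_fun 0 De; exists s; split=> // i j.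
  rewrite sn => i_n j_n; have := eM (Ordinal i_n) (Ordinal j_n).
  by rewrite !mxE -!sE.
have [inj_s rng_s] := A_chain_enum sn ch.
exists (fun i : 'I_n => s`_i); split=> //.
by apply/matrixP => i j; rewrite !mxE ch ?sn.
Qed.

Lemma simple_subsystem_chain Phi n D : is_root_system ip Phi ->
  simple_subsystem_A ip Phi n D <->
  exists s, [/\ size s = n, A_chain ip s, {subset s <= Phi} & D = [fset x in s]%fset].
Proof.
move=> rP; split=> [[[Psi [A _ Psi_in] [/fsubsetP DPsi _ _ _]]]|[s [sn ch sP ->]]].
  move=> /cartan_type_chain[s [sn ch DE]]; exists s; split=> // x xs.
  by have [] := (Psi_in x).1 _; rewrite // DPsi // DE !inE.
split; first exact: A_chain_simple_system.
by apply/cartan_type_chain; exists s.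
Qed.

End Diagrams.

Section Pairs.
Variables (R : realType) (V : vectType R) (ip : {dot V for idfun}).
Variables (Phi Pi : {fset V}).
Hypotheses (rootPhi : is_root_system ip Phi) (simplePi : is_simple_system Phi Pi).
Hypothesis crystPhi : crystallographic ip Phi.
Implicit Types (a b u v x y : V) (s : seq V) (w : 'End(V)) (D : {fset V}).

Local Notation coroot := (coroot ip).
Local Notation ext b := (b |` [fset - a | a in Pi])%fset.

Lemma ext_cases b x : (x \in ext b) = (x == b) || (- x \in Pi).
Proof.
rewrite !inE; congr (_ || _); apply/idP/idP => [/imfsetP[a aP ->]|xP].
  by rewrite opprK.
by apply/imfsetP; exists (- x); rewrite ?opprK.
Qed.

Lemma ext_root b x : dominant ip Phi Pi b -> x \in ext b -> x \in Phi.
Proof.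
move=> [bP _]; rewrite ext_cases => /orP[/eqP -> //|/(simple_root simplePi)].
by move=> /(rootN rootPhi); rewrite opprK.
Qed.

Lemma ext_obtuse b x y : dominant ip Phi Pi b -> x \in ext b -> y \in ext b ->
  x != y -> ip x y <= 0.
Proof.
move=> [_ bD]; rewrite !ext_cases.
move=> /orP[/eqP ->|xP] /orP[/eqP ->|yP] xy; first by rewrite eqxx in xy.
- by rewrite -[y]opprK ipNr oppr_le0 bD.
- by rewrite -[x]opprK ipNl oppr_le0 ipC bD.
- rewrite -[x]opprK -[y]opprK ipNl ipNr opprK (simple_obtuse rootPhi simplePi) //.
  by rewrite (inj_eq oppr_inj).
Qed.

Lemma linesE D x y : lines (dynkin ip D) x y =
  Num.max `|ip y (coroot x)| `|ip x (coroot y)|.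
Proof. by rewrite /= /cartan_integer !(ipC ip (coroot _)). Qed.

(** Two integers of absolute value at most 1 that are nonpositive and vanish
    together are known once their maximal absolute value is. *)
Lemma lines_pair D x y (c : bool) : x \in Phi -> y \in Phi -> ip x y <= 0 ->
  lines (dynkin ip D) x y = (if c then 1 else 0) ->
  ip x (coroot y) = if c then -1 else 0.
Proof.
move=> xP yP xy; rewrite linesE.
have x0 := root_neq0 rootPhi xP; have y0 := root_neq0 rootPhi yP.
have [p0|p0] := eqVneq (ip x (coroot y)) 0.
  have q0 : ip y (coroot x) = 0 by apply/eqP; rewrite pair_eq0 // ipC -pair_eq0 // p0.
  by rewrite p0 q0; case: c => //; rewrite normr0 maxxx => /eqP; rewrite eq_sym oner_eq0.
have neg : 1 <= - ip x (coroot y).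
  apply: int_ge1; first by rewrite rpredN crystPhi.
  by rewrite oppr_gt0 lt_def eq_sym p0 -oppr_ge0 -ipNl pair_ge0 // ipNl oppr_ge0.
case: c => e.
  have : `|ip x (coroot y)| <= 1 by rewrite -[leRHS]e le_max lexx orbT.
  by rewrite ler_norml => /andP[]; lra.
have : `|ip x (coroot y)| <= 0 by rewrite -[leRHS]e le_max lexx orbT.
by rewrite normr_le0 (negbTE p0).
Qed.

(** An edge of the diagram carries a single line exactly when both Cartan
    integers are -1, so the diagram determines the Cartan matrix. *)
Lemma diagram_chain n b D : dominant ip Phi Pi b -> (D `<=` ext b)%fset ->
  diagram_type_A n (full_subdiagram (extended_diagram ip Pi b) D) ->
  exists s, [/\ size s = n, A_chain ip s & D = [fset x in s]%fset].
Proof.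
move=> bD /fsubsetP Dext [e [ei De eL]].
have [s [sn sE DE]] := fset_of_ord_fun 0 De; exists s; split=> // i j.
rewrite sn => i_n j_n; rewrite -[i]/(val (Ordinal i_n)) -[j]/(val (Ordinal j_n)).
move: (Ordinal i_n) (Ordinal j_n) => {i_n j_n} i_n j_n; rewrite !sE.
have eD k : e k \in ext b.
  by apply: Dext; have : [set` D] (e k) by rewrite De; exists k.
have eP k : e k \in Phi := ext_root bD (eD k).
rewrite /cartan_entry; have [->|ij] := eqVneq i_n j_n.
  by rewrite eqxx pair_self // (root_neq0 rootPhi).
rewrite (negbTE (ij : val i_n != val j_n)).
have [L _] := eL i_n j_n ij.
apply: (@lines_pair (ext b)) L => //.
by apply: (ext_obtuse bD) => //; rewrite (inj_eq ei).
Qed.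

Lemma chain_diagram n b s : size s = n -> A_chain ip s ->
  diagram_type_A n (full_subdiagram (extended_diagram ip Pi b) [fset x in s]%fset).
Proof.
move=> sn ch; exists (fun i : 'I_n => s`_i).
have [inj_s rng_s] := A_chain_enum sn ch; split=> //.
move=> i j ij; have ijv : val i != val j by [].
have pE (k l : 'I_n) : val k != val l -> `|ip s`_k (coroot s`_l)| =
    if (k.+1 == l :> nat) || (l.+1 == k :> nat) then 1 else 0.
  move=> kl; rewrite ch ?sn // /cartan_entry (negbTE kl).
  by case: ifP => _; rewrite ?normrN ?normr1 ?normr0.
have ji : val j != val i by rewrite eq_sym.
rewrite [lines _ _ _]linesE !pE // [(j.+1 == i) || _]orbC maxxx; split=> //.
rewrite /= negb_and -!leNgt; apply/orP; right.
by rewrite /cartan_integer ipC pE //; case: ifP; rewrite ?ler01.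
Qed.

(** Only the two ends of a path have at most one neighbour. *)
Lemma terminal_chain s b : A_chain ip s -> b \in s ->
  terminal (full_subdiagram (extended_diagram ip Pi b) [fset x in s]%fset) b <->
  b = head 0 s \/ b = head 0 (rev s).
Proof.
move=> ch bs; have us := A_chain_uniq ch.
pose N := [fset a in [fset x in s] | (a != b) &&
  (lines (full_subdiagram (extended_diagram ip Pi b) [fset x in s]%fset) a b != 0)]%fset.
have [i si iE] := nthP 0 bs.
have nbr j : (j < size s)%N -> (s`_j \in N) = (j.+1 == i) || (i.+1 == j).
  move=> sj; rewrite !inE mem_nth //= -iE nth_uniq //.
  rewrite /cartan_integer !(ipC ip (coroot _)) !ch //.
  rewrite [cartan_entry _ i j]cartan_entryC maxxx normr_eq0 /cartan_entry.
  case: eqP => [->|_ /=]; first by rewrite orbb; apply/esym; lia.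
  by case: ifP => _; rewrite ?oppr_eq0 ?oner_eq0 ?eqxx.
have headE : head 0 s = s`_0 by case: (s).
have lastE : head 0 (rev s) = s`_(size s).-1.
  by rewrite -nth0 nth_rev ?subn1 //; case: (s) bs.
rewrite headE lastE; split=> [[_ N1]|bh].
  case: (posnP i) => [i0|i0]; first by left; rewrite -iE i0.
  have [il|il] := ltnP i.+1 (size s); last first.
    have last_idx n k : (k < n -> n <= k.+1 -> k = n.-1)%N by lia.
    by right; rewrite -iE; congr nth; exact: last_idx.
  have : ([fset s`_i.-1; s`_i.+1] `<=` N)%fset.
    apply/fsubsetP => x; rewrite in_fset2 => /orP[] /eqP ->.
      by rewrite nbr ?prednK ?eqxx // ltnW // ltnW.
    by rewrite nbr // eqxx orbT.
  move=> /fsubset_leq_card /leq_trans /(_ N1); rewrite cardfs2 nth_uniq //;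
    last exact: leq_ltn_trans (leq_pred i) si.
  have -> : (i.-1 == i.+1) = false by lia.
  by [].
split; first by rewrite /= !inE.
have [k Nk] : exists k, forall j, (j < size s)%N -> s`_j \in N -> j = k.
  have s0 : (0 < size s)%N := leq_ltn_trans (leq0n i) si.
  case: bh => bh.
    exists 1%N => j sj; rewrite nbr //.
    have -> : i = 0%N by apply/eqP; rewrite -(nth_uniq 0 _ _ us) ?iE ?bh.
    by move=> /orP[] /eqP.
  exists (size s).-2 => j sj; rewrite nbr //.
  have -> : i = (size s).-1.
    by apply/eqP; rewrite -(nth_uniq 0 _ _ us) ?iE ?bh // prednK.
  have idx n : (j < n -> (j.+1 == n.-1) || (n.-1.+1 == j) -> j = n.-2)%N by lia.
  exact: idx.
have : (N `<=` [fset s`_k])%fset.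
  apply/fsubsetP => x xN; have : x \in s by move: xN; rewrite !inE => /andP[].
  by move=> /(nthP 0)[j sj jE]; rewrite -jE in xN *; rewrite (Nk j) // inE.
by move=> /fsubset_leq_card; rewrite cardfs1.
Qed.

Lemma pairsP n b D : (0 < n)%N -> pairs_P ip Phi Pi n (b, D) <->
  exists s, [/\ normal ip Phi Pi s, size s = n, b = head 0 s & D = [fset x in s]%fset].
Proof.
move=> n0; split=> [[/= bD DE diag term]|[s [[ch hD tP] sn -> ->]]].
  have [s [sn ch sE]] := diagram_chain bD DE diag.
  have bs : b \in s by have := term.1; rewrite /= sE !inE.
  have [s' [ch' s'n ss' bh]] :
      exists s', [/\ A_chain ip s', size s' = n, s =i s' & b = head 0 s'].
    move: term; rewrite sE => /(terminal_chain ch bs) [h|h]; first by exists s.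
    exists (rev s); rewrite size_rev; split=> //; first exact: A_chain_rev.
    by move=> x; rewrite mem_rev.
  have DE' : D = [fset x in s']%fset by rewrite sE; apply/fsetP => x; rewrite !inE ss'.
  exists s'; split=> //; split=> //; first by rewrite -bh.
  case: s' => [|c t] in ch' s'n ss' bh DE' *; first by move=> x.
  rewrite /= in bh *; move=> x xt.
  have : x \in ext b by apply: (fsubsetP DE); rewrite DE' !inE xt orbT.
  rewrite ext_cases => /orP[/eqP e|//].
  by have := A_chain_uniq ch'; rewrite /= -bh -e xt.
case: s => [|b' t] in ch hD tP sn *; first by rewrite -sn in n0.
split=> //=.
- apply/fsubsetP => x; have := ext_cases b' x; rewrite !inE => -> /orP[-> //|/tP ->].
  exact: orbT.
- exact: chain_diagram.
- by apply/terminal_chain => //; [rewrite mem_head | left].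
Qed.

End Pairs.

(** * The bijection *)

Section Actions.
Variables (R : realType) (V : vectType R) (ip : {dot V for idfun}).
Implicit Types (w : 'End(V)) (s : seq V) (A D : {fset V}).

Lemma act_fset_seq w s : act_fset w [fset x in s]%fset = [fset x in map w s]%fset.
Proof.
apply/fsetP => y; rewrite inE; apply/imfsetP/mapP => [[x /= xs ->]|[x xs ->]];
  by exists x => //; move: xs; rewrite !inE.
Qed.

Lemma act_fset_comp w1 w2 D : act_fset (w1 \o w2)%VF D = act_fset w1 (act_fset w2 D).
Proof.
apply/fsetP => y; apply/imfsetP/imfsetP => [[x /= xD ->]|[z /= /imfsetP[x /= xD ->] ->]].
  by exists (w2 x); rewrite ?comp_lfunE //; apply/imfsetP; exists x.
by exists x; rewrite // comp_lfunE.
Qed.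

Lemma act_fset1 D : act_fset \1%VF D = D.
Proof.
apply/fsetP => y; apply/imfsetP/idP => [[x /= xD ->]|yD]; first by rewrite id_lfunE.
by exists y; rewrite ?id_lfunE.
Qed.

Lemma orbit_eqP A D D' :
  [set act_fset w D | w in refl_group ip A] = [set act_fset w D' | w in refl_group ip A]
  <-> exists2 w, refl_group ip A w & D' = act_fset w D.
Proof.
split=> [e|[w gw ->]].
  have : [set act_fset w D' | w in refl_group ip A] D'.
    by exists \1%VF; [exact: group1 | rewrite act_fset1].
  by rewrite -e => -[w gw wE]; exists w.
have [w' [gw' K K']] := groupV gw.
have w'w : (w' \o w)%VF = \1%VF by apply/lfunP => x; rewrite comp_lfunE K id_lfunE.
rewrite eqEsubset; split=> _ [u gu <-].
  exists (u \o w')%VF; first exact: groupM.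
  by rewrite act_fset_comp -(act_fset_comp w') w'w act_fset1.
by exists (u \o w)%VF; [exact: groupM | rewrite act_fset_comp].
Qed.

End Actions.

Theorem theorem6p7 (R : realType) (V : vectType R) (ip : {dot V for idfun})
    (Phi Pi : {fset V}) (n : nat) (w0 : 'End(V))
    (rootPhi : is_root_system ip Phi)
    (crystPhi : crystallographic ip Phi)
    (simplePi : is_simple_system Phi Pi)
    (n_gt0 : (1 <= n)%N)
    (longest_w0 : is_longest ip Phi Pi w0) :
  let W := refl_group ip Phi in
  let rho : 'End(V) := - w0 in
  let H : set 'End(V) := [set \1%VF; rho] in
  orbits (@act_fset R V) W (simple_subsystem_A ip Phi n) #=
  orbits (@act_pair R V) H (pairs_P ip Phi Pi n).
Proof.
cbv zeta; set W := refl_group ip Phi; set rho : 'End(V) := - w0.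
set H := [set \1%VF; rho].
have gw0 := longest_group rootPhi simplePi longest_w0.
have gS w : W w -> refl_group ip Pi w := refl_group_simple rootPhi simplePi (w := w).
have gP w : refl_group ip Pi w -> W w.
  by apply: groupS; exact: simple_sub simplePi.
have w0K := longestK rootPhi simplePi longest_w0.
have rhoE x : rho x = - w0 x by rewrite opp_lfunE.
have chainP := @simple_subsystem_chain _ _ ip Phi n _ rootPhi.
have pairP b D := pairsP rootPhi simplePi crystPhi b D n_gt0.
have subP s : normal ip Phi Pi s -> {subset s <= Phi}.
  case: s => [|b t] [ch [bP _] tP] x //; rewrite inE => /orP[/eqP -> //|/tP xP].
  rewrite -[x]opprK; apply: (rootN rootPhi); exact: (simple_root simplePi).
(* A pair is sent to the class of its second component; [F] is onto, and it
   remains to see that its fibres are the orbits of [rho]. *)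
pose F (p : V * {fset V}) := [set act_fset w p.2 | w in W].
pose G (p : V * {fset V}) := [set act_pair g p | g in H].
have -> : orbits (@act_fset R V) W (simple_subsystem_A ip Phi n) =
    F @` pairs_P ip Phi Pi n.
  rewrite eqEsubset; split=> S [].
    move=> D /chainP[s [sn ch sP ->]] <-.
    have s0 : s != [::] by rewrite -size_eq0 sn -lt0n.
    have [w gw nw] := normal_exists rootPhi simplePi crystPhi s0 sP ch.
    exists (head 0 (map w s), [fset x in map w s]%fset).
      by apply/pairP; exists (map w s); rewrite size_map.
    apply/esym/orbit_eqP; exists w; [exact: gP | by rewrite act_fset_seq].
  move=> [b D] /pairP[s [ns sn _ DE]] <-; exists D => //.
  apply/chainP; exists s; split=> //; [by case: ns | exact: subP].
apply: card_eq_image_kernel => -[b D] [b' D'].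
move=> /pairP[s [ns sn -> ->]] /pairP[s' [ns' sn' -> ->]].
have rho_normal := normal_rho rootPhi simplePi longest_w0 ns.
pose r := map (fun x => - w0 x) s.
have rho_act : act_pair rho (head 0 s, [fset x in s]%fset) =
    (head 0 r, [fset x in r]%fset).
  have -> : r = map rho s by apply: eq_map => x; rewrite rhoE.
  rewrite /act_pair act_fset_seq /=; congr (_, _).
  by case: (s) => [|c t] //=; rewrite rhoE -[0 in LHS](subrr 0) endB subrr oppr0.
have rhoK p : act_pair rho (act_pair rho p) = p.
  case: p => c E; rewrite /act_pair /= -act_fset_comp.
  have -> : (rho \o rho)%VF = \1%VF.
    by apply/lfunP => x; rewrite comp_lfunE !rhoE endN w0K opprK id_lfunE.
  by rewrite act_fset1 !rhoE endN w0K opprK.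
have act1 p : act_pair \1%VF p = p.
  by case: p => c E; rewrite /act_pair /= act_fset1 id_lfunE.
have GE p q : G p = G q <-> q = p \/ q = act_pair rho p.
  split=> [e|[->//|->]].
    have : G q q by exists \1%VF; [left | rewrite act1].
    by rewrite -e => -[g [->|->] <-]; [left; rewrite act1 | right].
  rewrite eqEsubset; split=> _ [g [->|->] <-].
  - by exists rho; [right | rewrite rhoK act1].
  - by exists \1%VF; [left | rewrite act1].
  - by exists rho; [right | rewrite act1].
  - by exists \1%VF; [left | rewrite act1 rhoK].
have [u [gu us _]] : exists u : 'End(V), [/\ refl_group ip [fset x in s]%fset u,
    map u s = map -%R (rev s) &
    forall a, A_chain ip (a :: s) -> u a = a + \sum_(x <- s) x].
  by apply: chain_flip; case: ns.
have gu' : refl_group ip Pi u.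
  by apply: gS; apply: groupS gu => x; rewrite !inE; apply: subP.
(* The flip of [s] followed by [w0] carries [s] to the reversal of [rho s]. *)
have rE : rev r = map (w0 \o u)%VF s.
  have -> : map (w0 \o u)%VF s = map w0 (map u s).
    by rewrite -map_comp; apply: eq_map => x; rewrite comp_lfunE.
  rewrite us -map_comp /r -map_rev; apply: eq_map => x /=; by rewrite endN.
rewrite GE rho_act; split=> [/orbit_eqP[w gw /=]|].
  rewrite act_fset_seq => e.
  have ch : A_chain ip (map w s) by apply: (A_chain_group gw); case: ns.
  have mem : map w s =i s'.
    by move=> x; have := congr1 (fun E : {fset V} => x \in E) e; rewrite !inE.
  have ch' : A_chain ip s' by case: ns'.
  have [s'E|s'E] := A_chain_eq_mem ch ch' mem.
    by left; rewrite (normal_uniq rootPhi simplePi ns ns' (gS _ gw) (esym s'E)).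
  (* [rev s] is conjugate to [r], so [r] and [s'] are normal and conjugate. *)
  right; suff -> : r = s' by [].
  have [v [gv vK Kv]] := groupV (groupM gw0 gu').
  apply: (normal_uniq rootPhi simplePi rho_normal ns' (w := (w \o v)%VF)).
    by apply: groupM => //; apply: gS.
  rewrite s'E -map_rev -[map _ s]/r.
  have -> : rev s = map v r.
    by rewrite -[r]revK rE map_rev -map_comp map_id_in // => x _; exact: vK.
  by rewrite -map_comp; apply: eq_map => x; rewrite comp_lfunE.
move=> [[_ ->]//|[_ ->]]; apply/orbit_eqP; exists (w0 \o u)%VF.
  by apply: gP; apply: groupM.
by rewrite act_fset_seq -rE; apply/fsetP => x; rewrite !inE mem_rev.
Qed.
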